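(* For every $n \geq 1$ there exists an $\operatorname{Sp}_{2n}(\mathbb{Z})$-equivariant surjection $$[-]: \mathbb{Z}[\operatorname{Sp}_{2n}(\mathbb{Z})] \twoheadrightarrow \operatorname{St}^\omega_n$$ such that the set of generators $\{[M] : M \in \operatorname{Sp}_{2n}(\mathbb{Z})\}$ of $\operatorname{St}^\omega_n$ is equal to the set of integral apartment classes.
   Context: Symplectic setup. $\mathbb{Q}^{2n}$ carries the standard symplectic form $\omega$: on the standard basis $\vec e_1,\vec f_1,\dots,\vec e_n,\vec f_n$ (in this order) one has $\omega(\vec e_i,\vec e_j)=\omega(\vec f_i,\vec f_j)=0$ for all $i,j$, $\omega(\vec e_i,\vec f_j)=0$ for $i\neq j$, and $\omega(\vec e_i,\vec f_i)=-\omega(\vec f_i,\vec e_i)=1$. $\operatorname{Sp}_{2n}(\mathbb{Z})$ is the group of automorphisms of $\mathbb{Z}^{2n}$ preserving $\omega$, identified with a group of $2n\times 2n$ matrices via this basis. A subspace $V\subseteq \mathbb{Q}^{2n}$ is isotropic if $\omega|_V=0$. Tits building and Steinberg module. $T^\omega_n$ is the poset of nonzero isotropic subspaces of $(\mathbb{Q}^{2n},\omega)$ ordered by inclusion (also regarded as a simplicial complex via its order complex); $\operatorname{Sp}_{2n}(\mathbb{Z})$ acts on it. The symplectic Steinberg module is the $\operatorname{Sp}_{2n}(\mathbb{Z})$-module $\operatorname{St}^\omega_n := \tilde H_{n-1}(T^\omega_n;\mathbb{Z})$. The group acts on $\mathbb{Z}[\operatorname{Sp}_{2n}(\mathbb{Z})]$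 by left multiplication. Integral apartment classes. Let $[\![n]\!] := \{1,\bar 1,\dots,n,\bar n\}$. A nonempty subset $I\subseteq [\![n]\!]$ is standard if $\{a,\bar a\}\not\subset I$ for all $1\le a\le n$. Let $\partial\beta_n$ be the simplicial complex with vertex set $[\![n]\!]$ whose $k$-simplices are the standard subsets of size $k+1$. One has $\partial\beta_1=\{1,\bar 1\}\cong S^0$ and $\partial\beta_{n+1}=\partial\beta_n * \{n+1,\overline{n+1}\}$ (simplicial join), so $\partial\beta_n$ is a simplicial $(n-1)$-sphere. Fix once and for all a fundamental class $\xi_0\in\tilde H_0(\partial\beta_1;\mathbb{Z})$; via the suspension isomorphisms it yields fundamental classes $\xi=\xi_{n-1}\in\tilde H_{n-1}(\partial\beta_n;\mathbb{Z})$ for all $n$. For a simplicial complex $K$ let $P(K)$ be its poset of simplices, whose order complex is the barycentric subdivision of $K$, and let $b:\tilde H_{*}(K;\mathbb{Z})\to\tilde H_{*}(P(K);\mathbb{Z})$ be the natural subdivision isomorphism. For $M\in \operatorname{Sp}_{2n}(\mathbb{Z})$, index its columns from left to right by $1,\bar 1,\dots,n,\bar n$, writing $M=(\vec M_a)_{a\in[\![n]\!]}$. If $I$ is a simplex of $\partial\beta_n$, then $M_I:=\langle \vec M_a : a\in I\rangle_{\mathbb{Q}}$ is isotropic, so there is a poset map $\partial M: P(\partial\beta_n)\to T^\omega_n$, $I\mapsto M_I$. The integral apartment class of $M$ is the image of $b(\xi)$ under the induced map $\partial M_\star:\tilde H_{n-1}(P(\partial\beta_n);\mathbb{Z})\to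 \operatorname{St}^\omega_n$, that is, $\partial M_\star(b(\xi))\in \operatorname{St}^\omega_n$. The set of integral apartment classes is $\{\partial M_\star(b(\xi)) : M\in \operatorname{Sp}_{2n}(\mathbb{Z})\}$. *)

(* Defs.v *)
From HB Require Import structures.
From mathcomp Require Import all_boot all_order all_algebra.
From mathcomp Require Import finmap monalg.
From mathcomp Require Import boolp classical_sets.

Set Implicit Arguments.
Unset Strict Implicit.
Unset Printing Implicit Defensive.

Import Order.TTheory GRing.Theory Num.Theory.
Local Open Scope ring_scope.

HB.lock Definition mlin (K : choiceType) (A : zmodType) (f : K -> A)
  (c : {malg int[K]}) : A := \sum_(k <- msupp c) f k *~ c@_k.

Section LinearExtension.
Variables (K : choiceType) (A : zmodType).
Implicit Types (f : K -> A) (c : {malg int[K]}).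

Lemma mlinEw f c (D : {fset K}) : (msupp c `<=` D)%fset ->
  mlin f c = \sum_(k <- D) f k *~ c@_k.
Proof.
move=> sD; rewrite mlin.unlock; apply: big_fset_incl => // k _ kN.
by rewrite mcoeff_outdom // mulr0z.
Qed.

Lemma mlin_is_additive f : zmod_morphism (mlin f).
Proof.
move=> c1 c2; pose D := (msupp c1 `|` msupp c2)%fset.
rewrite (@mlinEw _ _ D) ?msuppB_le // (@mlinEw _ c1 D) ?fsubsetUl //.
rewrite (@mlinEw _ c2 D) ?fsubsetUr // -sumrB.
by apply: eq_bigr => k _; rewrite mcoeffB mulrzBr.
Qed.

HB.instance Definition _ f :=
  GRing.isZmodMorphism.Build {malg int[K]} A (mlin f) (mlin_is_additive f).

Lemma mlinU f k z : mlin f << z *g k >> = f k *~ z.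
Proof.
rewrite (@mlinEw _ _ [fset k]%fset) ?msuppU_le //.
by rewrite big_seq_fset1 mcoeffUU.
Qed.

Lemma mlin1 f k : mlin f << k >> = f k.
Proof. by rewrite mlinU mulr1z. Qed.

Lemma malgU_int k (z : int) : << z *g k >> = << k >> *~ z :> {malg int[K]}.
Proof. by rewrite -raddfMz mulrzz mul1r. Qed.

Lemma additive_eq_in (F G : {additive {malg int[K]} -> A}) c :
  {in msupp c, forall k, F << k >> = G << k >>} -> F c = G c.
Proof.
move=> FG; rewrite {1 2}[c]monalgE !raddf_sum big_seq [RHS]big_seq.
by apply: eq_bigr => k kc; rewrite malgU_int !raddfMz FG.
Qed.
End LinearExtension.

Section Support.
Variables (K : choiceType) (P : pred K).

Definition supp_in : {pred {malg int[K]}} := fun c => all P (msupp c).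

Lemma supp_inP c : reflect {in msupp c, forall k, P k} (c \in supp_in).
Proof. exact: allP. Qed.

Lemma supp_in_zmod_closed : zmod_closed supp_in.
Proof.
split; first by rewrite unfold_in msupp0.
move=> c1 c2 /supp_inP h1 /supp_inP h2; apply/supp_inP => k.
by move/(fsubsetP (msuppB_le c1 c2)); rewrite in_fsetU => /orP[/h1|/h2].
Qed.
HB.instance Definition _ :=
  GRing.isZmodClosed.Build {malg int[K]} supp_in supp_in_zmod_closed.

Lemma supp_inU k z : P k -> << z *g k >> \in supp_in.
Proof.
move=> Pk; apply/supp_inP => k' /(fsubsetP msuppU_le).
by rewrite in_fset1 => /eqP->.
Qed.

Lemma mlin_supp_in (L : choiceType) (f : L -> {malg int[K]}) c :
  {in msupp c, forall k, f k \in supp_in} -> mlin f c \in supp_in.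
Proof.
by move=> h; rewrite mlin.unlock big_seq rpred_sum // => k kc; rewrite rpredMz ?h.
Qed.
End Support.

(* Vertices are partially ordered and every simplex is a chain, represented   *)
(* by the increasing list of its vertices. The empty list is the (-1)-simplex *)
(* of the augmented chain complex.                                            *)
Record complex d (V : porderType d) := Complex {
  simplex :> pred (seq V);
  simplex_sorted : forall s, simplex s -> sorted <%O s;
  simplex_subseq : forall s t, subseq s t -> simplex t -> simplex s
}.

Section Boundary.
Variable V : choiceType.
Implicit Types (x : V) (s : seq V) (c : {malg int[seq V]}).

Definition face i s := take i s ++ drop i.+1 s.

Definition bd1 s : {malg int[seq V]} :=
  \sum_(i < size s) << (-1) ^+ i *g face i s >>.

Definition bd c : {malg int[seq V]} := mlin bd1 c.
HB.instance Definition _ := GRing.Additive.copy bd (mlin bd1).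

Definition mcons x c : {malg int[seq V]} := mlin (fun s => << x :: s >>) c.
HB.instance Definition _ x :=
  GRing.Additive.copy (mcons x) (mlin (fun s => << x :: s >>)).

Definition mrcons x c : {malg int[seq V]} := mlin (fun s => << rcons s x >>) c.
HB.instance Definition _ x :=
  GRing.Additive.copy (mrcons x) (mlin (fun s => << rcons s x >>)).

Lemma bd_simplex s : bd << s >> = bd1 s.
Proof. exact: mlin1. Qed.

Lemma bd1_cons x s : bd1 (x :: s) = << s >> - mcons x (bd1 s).
Proof.
rewrite /bd1 /= big_ord_recl expr0 /face /= drop0; congr (_ + _).
rewrite (raddf_sum (mcons x)) -sumrN; apply: eq_bigr => i _ /=.
by rewrite /mcons mlinU -malgU_int -raddfN exprS mulN1r.
Qed.

Lemma bd1_rcons s x :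
  bd1 (rcons s x) = mrcons x (bd1 s) + << s >> *~ (-1) ^+ size s.
Proof.
rewrite /bd1 size_rcons big_ord_recr /=; congr (_ + _).
  rewrite (raddf_sum (mrcons x)); apply: eq_bigr => i _ /=.
  rewrite /mrcons mlinU -malgU_int /face; congr << _ *g _ >>.
  have lti := ltn_ord i.
  rewrite -!cats1 takel_cat; last exact: ltnW.
  by rewrite drop_cat ltn_neqAle lti andbT; case: eqP => [->|_];
     rewrite ?subnn ?drop0 ?drop_size -catA ?cats0.
rewrite -malgU_int /face -cats1 takel_cat // take_size drop_oversize ?cats0 //.
by rewrite size_cat addn1.
Qed.

Lemma bd_mcons x c : bd (mcons x c) = c - mcons x (bd c).
Proof.
pose F := GRing.Additive.clone _ _ (bd \o mcons x) _.
pose G := GRing.Additive.clone _ _ (idfun \- (mcons x \o bd)) _.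
suff: F c = G c by [].
apply: additive_eq_in => s _ /=.
by rewrite /mcons mlin1 !bd_simplex bd1_cons.
Qed.

Lemma bd_mrcons x (m : nat) c : c \in supp_in (fun s => size s == m) ->
  bd (mrcons x c) = mrcons x (bd c) + c *~ (-1) ^+ m.
Proof.
move/supp_inP=> hc.
have -> : c *~ (-1) ^+ m = mlin (fun s => << s >> *~ (-1) ^+ m) c.
  rewrite mlin.unlock {1}[c]monalgE mulrz_suml; apply: eq_bigr => s _.
  by rewrite malgU_int mulrzAC.
pose F := GRing.Additive.clone _ _ (bd \o mrcons x) _.
pose G := GRing.Additive.clone _ _
  ((mrcons x \o bd) \+ mlin (fun s => << s >> *~ (-1) ^+ m)) _.
suff: F c = G c by [].
apply: additive_eq_in => s /hc /eqP szs /=.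
by rewrite /mrcons !mlin1 !bd_simplex bd1_rcons szs.
Qed.

Lemma bd_bd c : bd (bd c) = 0.
Proof.
pose F := GRing.Additive.clone _ _ (bd \o bd) _.
suff: F c = (\0 : {additive _ -> {malg int[seq V]}}) c by [].
apply: additive_eq_in => s _ /=; rewrite bd_simplex.
elim: s => [|x s IHs]; first by rewrite /bd1 big_ord0 raddf0.
by rewrite bd1_cons raddfB /= bd_simplex bd_mcons IHs raddf0 subr0 subrr.
Qed.

Lemma face_subseq i s : subseq (face i s) s.
Proof.
rewrite -[X in subseq _ X](cat_take_drop i) cat_subseq //.
by rewrite -addn1 addnC -drop_drop drop_subseq.
Qed.

Lemma size_face i s : (i < size s)%N -> size (face i s) = (size s).-1.
Proof.
move=> lti; rewrite size_cat size_takel ?size_drop; last exact: ltnW.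
by rewrite subnS -subn1 addnBA ?subn_gt0 // subnKC ?subn1 // ltnW.
Qed.

Lemma bd1_supp s :
  bd1 s \in supp_in (fun t => subseq t s && (size t == (size s).-1)).
Proof.
rewrite rpred_sum // => i _; apply: supp_inU.
by rewrite face_subseq size_face ?eqxx.
Qed.
End Boundary.

Arguments bd {V} c.

Section Homology.
Variables (d : Order.disp_t) (V : porderType d) (K : complex V).

(* Chains spanned by the simplices with m vertices, i.e. of dimension m - 1. *)
Definition chains m : {pred {malg int[seq V]}} :=
  supp_in (fun s => K s && (size s == m)).
HB.instance Definition _ m := GRing.ZmodClosed.on (chains m).

Variable k : nat.

Definition cycles : {pred {malg int[seq V]}} :=
  fun c => (c \in chains k.+1) && (bd c == 0).

Lemma cycles_zmod_closed : zmod_closed cycles.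
Proof.
split; first by rewrite unfold_in rpred0 raddf0 /=.
move=> c1 c2 /andP[h1 /eqP b1] /andP[h2 /eqP b2].
by rewrite unfold_in rpredB //= raddfB /= b1 b2 subrr.
Qed.
HB.instance Definition _ :=
  GRing.isZmodClosed.Build {malg int[seq V]} cycles cycles_zmod_closed.

Record cycle_group := CycleGroup { cycle_val :> {malg int[seq V]};
                                   _ : cycle_val \in cycles }.
HB.instance Definition _ := [isSub for cycle_val].
HB.instance Definition _ := [Choice of cycle_group by <:].
HB.instance Definition _ := [SubChoice_isSubZmodule of cycle_group by <:].

Definition boundaries : {pred cycle_group} :=
  fun z => `[< exists2 e, e \in chains k.+2 & val z = bd e >].

Lemma boundaries_zmod_closed : zmod_closed boundaries.
Proof.
split; first by apply/asboolP; exists 0; rewrite ?rpred0 ?raddf0.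
move=> z1 z2 /asboolP[e1 h1 E1] /asboolP[e2 h2 E2]; apply/asboolP.
by exists (e1 - e2); rewrite ?rpredB // !raddfB /= E1 E2.
Qed.
HB.instance Definition _ :=
  GRing.isZmodClosed.Build cycle_group boundaries boundaries_zmod_closed.

(* As the empty simplex is a chain, this is reduced homology in degree k. *)
Definition rH : Type := {ideal_quot boundaries}.
HB.instance Definition _ := GRing.Zmodule.on rH.

(* The value at a chain that is not a cycle is the junk value 0; hmap_hclass *)
(* below shows that chain maps never meet it. *)
Definition hclass (c : {malg int[seq V]}) : rH :=
  \pi_(Quotient.quot boundaries)%qT (insubd (0 : cycle_group) c).
End Homology.

Section InducedMap.
Variables (d d' : Order.disp_t) (V : porderType d) (W : porderType d').
Variables (K : complex V) (L : complex W).

Definition chain_map (r : nat) (F : {malg int[seq V]} -> {malg int[seq W]}) : Prop :=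
  forall (m : nat) c, c \in chains K m ->
    F c \in chains L (r + m)%N /\ bd (F c) = F (bd c).

Definition hmap k l (F : {malg int[seq V]} -> {malg int[seq W]})
  (x : rH K k) : rH L l := hclass L l (F (val (repr x))).
End InducedMap.

Lemma hmap_hclass d d' (V : porderType d) (W : porderType d')
    (K : complex V) (L : complex W) (r k : nat)
    (F : {additive {malg int[seq V]} -> {malg int[seq W]}}) c :
  chain_map K L r F -> c \in cycles K k ->
  hmap L (r + k)%N F (hclass K k c) = hclass L (r + k)%N (F c).
Proof.
move=> cF cc.
have cycF z : z \in cycles K k -> F z \in cycles L (r + k)%N.
  case/andP=> /cF[Fz bFz] /eqP bz.
  by rewrite unfold_in -addnS Fz bFz bz raddf0 /=.
rewrite /hmap; set z := repr _.
have /eqP : hclass K k z = hclass K k c.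
  by rewrite /hclass valKd reprK.
rewrite /hclass -Quotient.idealrBE => /asboolP[e he].
rewrite raddfB /= valKd !insubdK // => E.
apply/eqP; rewrite -Quotient.idealrBE; apply/asboolP.
exists (F e); first by have [] := cF _ _ he; rewrite !addnS.
rewrite raddfB /= !insubdK ?cycF //; last exact: valP.
by have [_ ->] := cF _ _ he; rewrite -E raddfB.
Qed.

Section OrderComplex.
Variables (d : Order.disp_t) (P : porderType d).

Fact order_complex_sorted (s : seq P) : sorted <%O s -> sorted <%O s.
Proof. by []. Qed.

Fact order_complex_subseq (s t : seq P) :
  subseq s t -> sorted <%O t -> sorted <%O s.
Proof. exact: subseq_lt_sorted. Qed.

Definition order_complex : complex P :=
  Complex order_complex_sorted order_complex_subseq.
End OrderComplex.

Section PosetMap.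
Variables (d d' : Order.disp_t) (P : porderType d) (Q : porderType d').
Variable f : P -> Q.

(* A simplex whose vertices are not mapped injectively is sent to 0. *)
Definition push : {malg int[seq P]} -> {malg int[seq Q]} :=
  mlin (fun s => if uniq (map f s) then << map f s >> else 0).
HB.instance Definition _ := GRing.Additive.on push.

Lemma push_mcons x c : push (mcons x c) =
  mcons (f x) (mlin (fun s => if uniq (f x :: map f s) then << map f s >>
                              else 0) c).
Proof.
pose G := mlin (fun s => if uniq (f x :: map f s) then
                  << map f s >> : {malg int[seq Q]} else 0).
pose F1 := GRing.Additive.clone _ _ (push \o mcons x) _.
pose F2 := GRing.Additive.clone _ _ (mcons (f x) \o G) _.
suff: F1 c = F2 c by [].
apply: additive_eq_in => s _ /=; rewrite /push /mcons /G !mlin1 /=.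
by case: ifP; rewrite ?mlin1 ?raddf0.
Qed.

Hypothesis f_homo : {homo f : x y / (x <= y)%O}.

Lemma push_chain_map :
  chain_map (order_complex P) (order_complex Q) 0 push.
Proof.
move=> m c /supp_inP hc; split.
  apply: mlin_supp_in => s /hc /andP[/= ss sz].
  case: ifP => [us|_]; last exact: rpred0.
  apply: supp_inU; rewrite /= add0n size_map sz andbT lt_sorted_uniq_le us /=.
  by apply: (homo_sorted f_homo); move: ss; rewrite lt_sorted_uniq_le => /andP[].
pose F := GRing.Additive.clone _ _ (bd \o push) _.
pose G := GRing.Additive.clone _ _ (push \o bd) _.
suff: F c = G c by [].
apply: additive_eq_in => s /hc /andP[/= ss _] /=; rewrite bd_simplex.
elim: s ss => [|x s IHs] ss.
  by rewrite /push mlin1 bd_simplex /bd1 !big_ord0 raddf0.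
have {}IHs := IHs (path_sorted ss).
have lex y : y \in s -> (x < y)%O.
  by move: ss; rewrite /= lt_path_sortedE => /andP[/allP h _] /h.
have subs t : t \in msupp (bd1 s) -> subseq t s.
  by move/(supp_inP _ _ (bd1_supp s)) => /andP[].
rewrite bd1_cons raddfB /= push_mcons.
case: (boolP (f x \in map f s)) => fx; last first.
  have -> : push << x :: s >> = mcons (f x) (push << s >>).
    by rewrite /push !mlin1 /= fx /=; case: ifP => _; rewrite /mcons ?mlin1 ?raddf0.
  rewrite bd_mcons IHs; congr (_ - mcons _ _).
  apply: additive_eq_in => t /subs ts; rewrite /= /push !mlin1 /=.
  suff -> : f x \notin map f t by [].
  by apply: contra fx; apply: mem_subseq; apply: map_subseq.
have -> : push << x :: s >> = 0 by rewrite /push mlin1 /= fx.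
rewrite raddf0; case: s fx {IHs} ss lex subs => // y s fx ss lex _.
have fxy : f x = f y.
  apply/le_anti; rewrite f_homo ?(ltW (lex _ _)) ?mem_head //=.
  have /mapP[z] := fx; rewrite inE => /orP[/eqP->->//|zs ->].
  apply: f_homo; apply: ltW.
  have := path_sorted ss; rewrite /= lt_path_sortedE => /andP[/allP h _].
  exact: h.
rewrite bd1_cons raddfB /= mlin1 [X in mcons _ (_ - X)](_ : _ = 0).
  rewrite subr0 /push /mcons mlin1 /= fxy.
  by case: ifP => _; rewrite ?mlin1 ?subrr // (raddf0 (mlin _)) subrr.
pose H := mlin (fun s => if uniq (f x :: map f s) then
                  << map f s >> : {malg int[seq Q]} else 0).
pose F' := GRing.Additive.clone _ _ (H \o mcons y) _.
suff: F' (bd1 s) = (\0 : {additive _ -> {malg int[seq Q]}}) (bd1 s) by [].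
apply: additive_eq_in => t _ /=.
by rewrite /H /mcons !mlin1 /= fxy inE eqxx.
Qed.
End PosetMap.

Fact simplices_display : Order.disp_t. Proof. exact: Order.Disp tt tt. Qed.

Section Subdivision.
Variables (d : Order.disp_t) (V : porderType d) (K : complex V).

(* The poset P(K) of nonempty simplices. For increasing lists of vertices,    *)
(* being a subsequence amounts to inclusion of the sets of vertices.          *)
Record simplices := Simplices {
  vertices :> seq V;
  _ : K vertices && (vertices != [::])
}.
HB.instance Definition _ := [isSub for vertices].
HB.instance Definition _ := [Choice of simplices by <:].

Definition simplices_le (s t : simplices) := subseq s t.

Fact simplices_le_refl : reflexive simplices_le.
Proof. by move=> s; apply: subseq_refl. Qed.
Fact simplices_le_anti : antisymmetric simplices_le.
Proof. by move=> s t /subseq_anti /val_inj. Qed.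
Fact simplices_le_trans : transitive simplices_le.
Proof. by move=> t s u; apply: subseq_trans. Qed.
HB.instance Definition _ := Order.Le_isPOrder.Build simplices_display simplices
  simplices_le_refl simplices_le_anti simplices_le_trans.

Lemma simplices_leE (s t : simplices) :
  (s <= t)%O = all (mem (vertices t)) (vertices s).
Proof.
apply/idP/allP => [st|st]; first exact: mem_subseq.
have srt (x : simplices) : sorted <%O (vertices x).
  by case: x => x /= /andP[/simplex_sorted].
change (is_true (subseq s t)).
suff -> : vertices s = [seq x <- t | x \in vertices s] by apply: filter_subseq.
apply: (irr_sorted_eq lt_trans ltxx (srt s)).
  exact: (sorted_filter lt_trans).
by move=> x; rewrite mem_filter andb_idr // => /st.
Qed.

(* sd(s) is the cone over sd(bd s) whose apex is the barycenter s of s. The   *)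
(* apex is the largest vertex, hence is listed last: the sign turns the       *)
(* right cone into a chain map.                                               *)
Fixpoint sd_rec m (s : seq V) : {malg int[seq simplices]} :=
  if m isn't m'.+1 then << [::] >> else
  if insub s isn't Some b then 0 else
  mrcons b (mlin (sd_rec m') (bd1 s)) *~ (-1) ^+ m'.

Definition sd : {malg int[seq V]} -> {malg int[seq simplices]} :=
  mlin (fun s => sd_rec (size s) s).
HB.instance Definition _ := GRing.Additive.on sd.

Lemma sd_rec_supp s : K s -> sd_rec (size s) s \in
  supp_in (fun t => [&& sorted <%O t, size t == size s &
                        all (fun b => subseq (vertices b) s) t]).
Proof.
move sz: (size s) => m; elim: m s sz => [|m IHm] s sz Ks.
  exact: supp_inU.
rewrite /=; case: insubP => [b _ bs|_]; last exact: rpred0.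
rewrite rpredMz // mlin.unlock.
rewrite /mrcons; apply: mlin_supp_in => t tc; apply: supp_inU.
have : mlin (sd_rec m) (bd1 s) \in supp_in (fun t =>
    [&& sorted <%O t, size t == m & all (fun b' => (b' < b)%O) t]).
  apply: mlin_supp_in => u /(supp_inP _ _ (bd1_supp s)) /andP[us].
  rewrite sz => /eqP/= szu.
  have := IHm u szu (simplex_subseq us Ks) => /supp_inP hu.
  apply/supp_inP => v /hu /and3P[-> -> /allP sv] /=.
  apply/allP => b' /sv b'u; rewrite lt_def.
  have b'u' : subseq (vertices b') s by apply: subseq_trans us.
  rewrite [X in _ && X](_ : _ = subseq (vertices b') (vertices b)) // bs b'u'.
  rewrite andbT; apply/eqP => bb'; have := size_subseq b'u.
  by rewrite -bb' bs sz szu ltnn.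
rewrite mlin.unlock => /supp_inP /(_ t tc) /and3P[st /eqP zt /allP lt].
rewrite size_rcons zt eqxx /=; apply/andP; split; last first.
  rewrite all_rcons /= bs subseq_refl /=; apply/allP => b' /lt /ltW.
  by rewrite -bs.
rewrite (sorted_pairwise lt_trans) pairwise_rcons.
rewrite -(sorted_pairwise lt_trans) st andbT.
by apply/allP => b' /lt.
Qed.

Lemma sd_chain_map : chain_map K (order_complex simplices) 0 sd.
Proof.
move=> m c /supp_inP hc; split.
  apply: mlin_supp_in => s /hc /andP[Ks /eqP szs].
  apply/supp_inP => t /(supp_inP _ _ (sd_rec_supp Ks)) /and3P[st zt _].
  by rewrite /= st add0n -szs.
pose F := GRing.Additive.clone _ _ (bd \o sd) _.
pose G := GRing.Additive.clone _ _ (sd \o bd) _.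
suff: F c = G c by [].
apply: additive_eq_in => s /hc /andP[Ks _] /=.
rewrite bd_simplex /sd mlin1.
move sz: (size s) => k; elim: k s sz Ks => [|k IHk] s sz Ks.
  by move/size0nil: sz => ->; rewrite /= bd_simplex /bd1 /= !big_ord0 raddf0.
have sub t : t \in msupp (bd1 s) -> K t /\ size t = k.
  move/(supp_inP _ _ (bd1_supp s)) => /andP[ts /eqP ->]; rewrite sz.
  by split=> //; apply: simplex_subseq Ks.
have eq_sd : mlin (sd_rec k) (bd1 s) = sd (bd1 s).
  by apply: additive_eq_in => t /sub[_ zt] /=; rewrite /sd !mlin1 zt.
have bd_sd : bd (sd (bd1 s)) = 0.
  pose H := GRing.Additive.clone _ _ (bd \o sd) _.
  pose H' := GRing.Additive.clone _ _ (sd \o bd) _.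
  suff: H (bd1 s) = H' (bd1 s).
    by rewrite /= -bd_simplex bd_bd raddf0.
  apply: additive_eq_in => t /sub[Kt zt] /=.
  by rewrite bd_simplex {1}/sd mlin1 zt IHk.
rewrite /= insubT ?Ks -?size_eq0 ?sz // => ss.
rewrite raddfMz /= eq_sd (@bd_mrcons _ _ k) ?bd_sd ?raddf0 ?add0r.
  by rewrite -mulrzA -exprD addnn -mul2n exprM sqrrN expr1n.
apply: mlin_supp_in => t /sub[Kt zt].
apply/supp_inP => u /(supp_inP _ _ (sd_rec_supp Kt)) /and3P[_].
by rewrite zt.
Qed.
End Subdivision.

(* Counting from 0, (i, false) is the letter i + 1 and (i, true) the barred   *)
(* letter; the order is 1 < 1bar < 2 < 2bar < ...                             *)
Notation letter n := ('I_n *l bool)%type.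

Definition standard n (s : seq (letter n)) : bool :=
  [forall a : 'I_n, ~~ [&& ((a, false) : letter n) \in s
                         & ((a, true) : letter n) \in s]].

Section Sphere.
Variable n : nat.

Definition dbeta_simplex (s : seq (letter n)) : bool :=
  sorted <%O s && standard s.

Fact dbeta_sorted s : dbeta_simplex s -> sorted <%O s.
Proof. by case/andP. Qed.

Fact dbeta_subseq s t : subseq s t -> dbeta_simplex t -> dbeta_simplex s.
Proof.
move=> st /andP[sor /forallP std]; apply/andP; split.
  exact: subseq_lt_sorted sor.
apply/forallP => a; apply: contra (std a) => /andP[h1 h2].
by rewrite !(mem_subseq st).
Qed.

Definition dbeta : complex (letter n) := Complex dbeta_sorted dbeta_subseq.
End Sphere.

Section Suspension.
Variable n : nat.

Definition widen_letter (a : letter n) : letter n.+1 :=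
  (widen_ord (leqnSn n) a.1, a.2).

Definition join_letter (b : bool) (s : seq (letter n)) : seq (letter n.+1) :=
  rcons (map widen_letter s) (ord_max, b).

(* The suspension isomorphism H_k(dbeta n) -> H_k.+1(dbeta n.+1), where       *)
(* dbeta n.+1 is the join of dbeta n with the two new vertices.               *)
Definition susp : {malg int[seq (letter n)]} -> {malg int[seq (letter n.+1)]} :=
  mlin (fun s => << join_letter false s >> - << join_letter true s >>).
HB.instance Definition _ := GRing.Additive.on susp.

Lemma widen_letter_lt : {homo widen_letter : a b / (a < b)%O}.
Proof. by move=> [i b] [j c]; rewrite !ltEprodlexi. Qed.

Lemma widen_letter_inj : injective widen_letter.
Proof. by move=> [i b] [j c] [ij ->]; congr (_, _); apply: val_inj. Qed.

Lemma join_letter_dbeta b s :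
  dbeta n s -> dbeta n.+1 (join_letter b s).
Proof.
case/andP=> sor /forallP std; apply/andP; split.
  rewrite (sorted_pairwise lt_trans) pairwise_rcons.
  rewrite -(sorted_pairwise lt_trans) (homo_sorted widen_letter_lt) // andbT.
  rewrite all_map; apply/allP => [[i c] _] /=.
  rewrite ltEprodlexi /= leEord /= ltnW ?ltn_ord //=.
  by rewrite leqNgt ltn_ord.
have mem (a : 'I_n.+1) c : ((a, c) : letter n.+1) \in join_letter b s ->
    (a, c) = (ord_max, b) \/
    exists2 i : 'I_n, a = widen_ord (leqnSn n) i & ((i, c) : letter n) \in s.
  rewrite mem_rcons inE => /orP[/eqP|/mapP[[i c'] si [-> ->]]]; first by left.
  by right; exists i.
apply/forallP => a; apply/negP => /andP[/mem m1 /mem m2].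
case: m1 m2 => [[-> <-]|[i -> si]] [].
- by [].
- by move=> [j /(congr1 (@nat_of_ord _)) /= jn _];
    have := ltn_ord j; rewrite -jn ltnn.
- by move=> [jn _]; have := ltn_ord i; rewrite jn ltnn.
move=> [j /(congr1 (@nat_of_ord _)) /= ij sj].
have /negP[] := std i; rewrite si.
by rewrite (_ : i = j) //; apply: val_inj.
Qed.

Lemma susp_chain_map : chain_map (dbeta n) (dbeta n.+1) 1 susp.
Proof.
move=> m c /supp_inP hc; split.
  apply: mlin_supp_in => s /hc /andP[Ks /eqP szs].
  by rewrite rpredB // supp_inU // join_letter_dbeta //
     size_rcons size_map szs add1n eqxx.
pose J b : {malg int[seq (letter n)]} -> {malg int[seq (letter n.+1)]} :=
  mlin (fun s => << join_letter b s >>).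
have bdJ b s : bd << join_letter b s >> =
    J b (bd1 s) + << map widen_letter s >> *~ (-1) ^+ size s.
  rewrite bd_simplex /join_letter bd1_rcons size_map; congr (_ + _).
  rewrite /bd1 size_map (raddf_sum (mrcons _)) /J raddf_sum.
  apply: eq_bigr => i _ /=.
  by rewrite /mrcons !mlinU /face /join_letter map_cat map_take map_drop.
have suspJ e : susp e = J false e - J true e.
  pose F := GRing.Additive.clone _ _ susp _.
  pose G := GRing.Additive.clone _ _
    ((mlin (fun s => << join_letter false s >>) : {malg int[seq (letter n)]} ->
     {malg int[seq (letter n.+1)]}) \-
     mlin (fun s => << join_letter true s >>)) _.
  suff: F e = G e by [].
  by apply: additive_eq_in => s _ /=; rewrite /susp !mlin1.
pose F := GRing.Additive.clone _ _ (bd \o susp) _.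
pose G := GRing.Additive.clone _ _ (susp \o bd) _.
suff: F c = G c by [].
apply: additive_eq_in => s _ /=; rewrite bd_simplex !suspJ.
have J1 b : J b << s >> = << join_letter b s >> by rewrite /J mlin1.
by rewrite !J1 raddfB /= !bdJ opprD addrACA subrr addr0.
Qed.
End Suspension.

Definition subdivision d (V : porderType d) (K : complex V) k :
  rH K k -> rH (order_complex (simplices K)) k :=
  hmap _ k (@sd d V K).

(* A fundamental class of the 0-sphere dbeta 1: a generator of H_0 = Z. *)
Definition is_fundamental (xi0 : rH (dbeta 1) 0) : Prop :=
  forall x, exists k : int, x = xi0 *~ k.

(* The class xi_n in H_n(dbeta n.+1) obtained from xi0 by suspension. *)
Fixpoint xi (xi0 : rH (dbeta 1) 0) n : rH (dbeta n.+1) n :=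
  if n is m.+1 then hmap (dbeta m.+2) m.+1 (@susp m.+1) (xi xi0 m) else xi0.

(* Only meaningful for n > 0, like St n below. *)
Definition fundamental_class (xi0 : rH (dbeta 1) 0) n : rH (dbeta n) n.-1 :=
  if n is m.+1 then xi xi0 m else 0.

(* The coordinates of R^2n are e_1, f_1, ..., e_n, f_n in this order; the     *)
(* letter (i, false) stands for e_(i+1) and (i, true) for f_(i+1).            *)
Fact basis_index_subproof n (a : letter n) : (a.1.*2 + a.2 < n.*2)%N.
Proof.
case: a => i b /=; apply: (@leq_trans i.+1.*2); last by rewrite leq_double.
by rewrite doubleS; case: b; rewrite ?addn1 ?addn0.
Qed.
Definition basis_index n (a : letter n) : 'I_(n.*2) := Ordinal (basis_index_subproof a).

Section Omega.
Variables (R : comNzRingType) (n : nat).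
Implicit Types (u v w : 'cV[R]_(n.*2)).

Definition omega u v : R :=
  \sum_(i < n) (u (basis_index (i, false)) 0 * v (basis_index (i, true)) 0 -
                u (basis_index (i, true)) 0 * v (basis_index (i, false)) 0).

Lemma omega_is_linearl v : scalar (omega^~ v).
Proof.
move=> k u w; rewrite /omega mulr_sumr -big_split; apply: eq_bigr => i _ /=.
by rewrite !mxE !mulrDl mulrBr !mulrA opprD addrACA.
Qed.

Lemma omega_is_linearr u : scalar (omega u).
Proof.
move=> k v w; rewrite /omega mulr_sumr -big_split; apply: eq_bigr => i _ /=.
rewrite !mxE mulrBr !mulrDr opprD addrACA.
by rewrite ![k * (_ * _)]mulrCA.
Qed.
HB.instance Definition _ u := GRing.isLinear.Build R _ _ _ (omega u)
  (omega_is_linearr u).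

Lemma omega_suml (I : Type) (r : seq I) (F : I -> 'cV[R]_(n.*2)) v :
  omega (\sum_(i <- r) F i) v = \sum_(i <- r) omega (F i) v.
Proof.
elim: r => [|i r IHr]; rewrite ?big_nil ?big_cons.
  by rewrite /omega big1 // => i _; rewrite !mxE !mul0r subrr.
have := omega_is_linearl v 1 (F i) (\sum_(j <- r) F j).
by rewrite scale1r /= mul1r IHr => ->.
Qed.

Lemma omegaZl k u v : omega (k *: u) v = k * omega u v.
Proof.
rewrite /omega mulr_sumr; apply: eq_bigr => i _.
by rewrite !mxE mulrBr !mulrA.
Qed.
End Omega.

Lemma basis_index_inj n : injective (@basis_index n).
Proof.
move=> [i b] [j c] /(congr1 val) /= ij.
have hb : b = c.
  by have := congr1 odd ij; rewrite !oddD !odd_double /= !oddb.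
rewrite hb in ij *; congr (_, _); apply: val_inj.
by move/addIn/double_inj: ij.
Qed.

Lemma omega_delta (R : comNzRingType) n (a b : letter n) :
  omega (delta_mx (basis_index a) 0 : 'cV[R]_(n.*2)) (delta_mx (basis_index b) 0) =
  if a.1 == b.1 then b.2%:R - a.2%:R else 0.
Proof.
have E (x y : letter n) : (basis_index x == basis_index y) = (x.1 == y.1) && (x.2 == y.2).
  by rewrite (inj_eq (@basis_index_inj n)) -pair_eqE.
case: a b => [i b] [j c]; rewrite /omega (bigD1 i) //= big1 ?addr0.
  rewrite !mxE !E /= !eqxx /=.
  by case: (i == j); case: b; case: c;
    rewrite /= ?mulr0 ?mul0r ?mulr1 ?subr0 ?sub0r ?subrr ?oppr0.
by move=> k ki; rewrite !mxE !E /= (negPf ki) /= !mul0r subrr.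
Qed.

Lemma omega_map (R S : comNzRingType) (f : {rmorphism R -> S}) n
    (u v : 'cV[R]_(n.*2)) :
  omega (map_mx f u) (map_mx f v) = f (omega u v).
Proof.
rewrite /omega rmorph_sum; apply: eq_bigr => i _.
by rewrite !mxE rmorphB !rmorphM.
Qed.

Definition is_symplectic n (M : 'M[int]_(n.*2)) : bool :=
  (M \in unitmx) && `[< forall u v, omega (M *m u) (M *m v) = omega u v >].

Record Sp n := MkSp { Sp_mx :> 'M[int]_(n.*2); _ : is_symplectic Sp_mx }.
HB.instance Definition _ n := [isSub for @Sp_mx n].
HB.instance Definition _ n := [Choice of Sp n by <:].

Section SpGroup.
Variable n : nat.
Implicit Types M N : Sp n.

Lemma Sp_unit M : (M : 'M_(n.*2)) \in unitmx.
Proof. by case/andP: (valP M). Qed.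

Lemma Sp_omega M u v : omega (M *m u) (M *m v) = omega u v.
Proof. by have /andP[_ /asboolP] := valP M; apply. Qed.

Fact Sp1_subproof : is_symplectic (1%:M : 'M[int]_(n.*2)).
Proof.
by rewrite /is_symplectic unitmx1; apply/asboolP => u v; rewrite !mul1mx.
Qed.
Fact SpV_subproof M : is_symplectic (invmx M).
Proof.
rewrite /is_symplectic unitmx_inv Sp_unit; apply/asboolP => u v.
by rewrite -(Sp_omega M) !mulKVmx ?Sp_unit.
Qed.
Fact SpM_subproof M N : is_symplectic (M *m N).
Proof.
rewrite /is_symplectic unitmx_mul !Sp_unit; apply/asboolP => u v.
by rewrite -!mulmxA !Sp_omega.
Qed.
Definition Sp1 : Sp n := MkSp Sp1_subproof.
Definition SpV M : Sp n := MkSp (SpV_subproof M).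
Definition SpM M N : Sp n := MkSp (SpM_subproof M N).

Fact SpMA : associative SpM.
Proof. by move=> M N P; apply: val_inj; apply: mulmxA. Qed.
Fact Sp1M : left_id Sp1 SpM.
Proof. by move=> M; apply: val_inj; apply: mul1mx. Qed.
Fact SpM1 : right_id Sp1 SpM.
Proof. by move=> M; apply: val_inj; apply: mulmx1. Qed.
Fact SpVM : left_inverse Sp1 SpV SpM.
Proof. by move=> M; apply: val_inj; apply: mulVmx; apply: Sp_unit. Qed.
Fact SpMV : right_inverse Sp1 SpV SpM.
Proof. by move=> M; apply: val_inj; apply: mulmxV; apply: Sp_unit. Qed.
HB.instance Definition _ := isGroup.Build (Sp n) SpMA Sp1M SpM1 SpVM SpMV.
End SpGroup.

Definition isotropic n (U : {vspace 'cV[rat]_(n.*2)}) : bool :=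
  `[< forall u v, u \in U -> v \in U -> omega u v = 0 >].

Record Tits n := MkTits {
  Tits_space :> {vspace 'cV[rat]_(n.*2)};
  _ : isotropic Tits_space && (Tits_space != 0%VS)
}.
HB.instance Definition _ n := [isSub for @Tits_space n].
HB.instance Definition _ n := [Choice of Tits n by <:].

Section TitsOrder.
Variable n : nat.
Fact Tits_display : Order.disp_t. Proof. exact: Order.Disp tt tt. Qed.
Definition Tits_le (U W : Tits n) : bool := (U <= W)%VS.
Fact Tits_le_refl : reflexive Tits_le.
Proof. by move=> U; apply: subvv. Qed.
Fact Tits_le_anti : antisymmetric Tits_le.
Proof. by move=> U W UW; apply/val_inj/eqP; rewrite eqEsubv. Qed.
Fact Tits_le_trans : transitive Tits_le.
Proof. by move=> U W X; apply: subv_trans. Qed.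
HB.instance Definition _ := Order.Le_isPOrder.Build Tits_display (Tits n)
  Tits_le_refl Tits_le_anti Tits_le_trans.
End TitsOrder.

Definition St n : Type := rH (order_complex (Tits n)) n.-1.
HB.instance Definition _ n := GRing.Zmodule.on (St n).

Section Action.
Variables (n : nat) (g : Sp n).

Definition Sp_rat : 'M[rat]_(n.*2) := map_mx intr g.

Lemma Sp_rat_unit : Sp_rat \in unitmx.
Proof.
have /(congr1 (map_mx (intr : int -> rat))) := mulmxV (Sp_unit g).
by rewrite map_mxM map_mx1 => /mulmx1_unit[].
Qed.

Lemma Sp_rat_omega u v : omega (Sp_rat *m u) (Sp_rat *m v) = omega u v.
Proof.
have E (w : 'cV[rat]_(n.*2)) : w = \sum_i w i 0 *: delta_mx i 0.
  rewrite {1}[w]matrix_sum_delta; apply: eq_bigr => i _.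
  by rewrite big_ord1 (ord1 0).
have D i : delta_mx i 0 = map_mx intr (delta_mx i 0) :> 'cV[rat]_(n.*2).
  by apply/matrixP => r c; rewrite !mxE; case: (_ && _).
rewrite (E u) (E v) !mulmx_sumr !omega_suml; apply: eq_bigr => i _.
rewrite -!scalemxAr !omegaZl !linear_sum; congr (_ * _).
apply: eq_bigr => j _; rewrite -!scalemxAr !linearZ /=; congr (_ * _).
by rewrite !D -!map_mxM !omega_map Sp_omega.
Qed.

Definition act_space (U : {vspace 'cV[rat]_(n.*2)}) :
  {vspace 'cV[rat]_(n.*2)} := (linfun (mulmx Sp_rat) @: U)%VS.

Fact act_Tits_subproof (U : Tits n) :
  isotropic (act_space U) && (act_space U != 0%VS).
Proof.
case: U => U /= /andP[/asboolP isoU U0]; apply/andP; split.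
  apply/asboolP => _ _ /memv_imgP[u uU ->] /memv_imgP[v vU ->].
  by rewrite !lfunE /= Sp_rat_omega isoU.
apply: contra U0 => /eqP U0; rewrite -subv0; apply/subvP => u uU.
have : linfun (mulmx Sp_rat) u \in act_space U by apply: memv_img.
rewrite U0 lfunE /= [X in is_true X -> _]memv0 => /eqP gu0.
by rewrite -(mulKmx Sp_rat_unit u) gu0 mulmx0 mem0v.
Qed.

Definition act_Tits (U : Tits n) : Tits n := MkTits (act_Tits_subproof U).

Lemma act_Tits_homo : {homo act_Tits : U W / (U <= W)%O}.
Proof. by move=> U W UW; apply: limgS. Qed.

Definition act_St : St n -> St n := hmap _ _ (push act_Tits).

Definition lmulg : {malg int[Sp n]} -> {malg int[Sp n]} :=
  mlin (fun h => << (g * h)%g >>).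
End Action.

Section Apartment.
Variables (n : nat) (M : Sp n).

Definition column (a : letter n) : 'cV[rat]_(n.*2) :=
  map_mx intr (col (basis_index a) M).

Definition apartment_space (I : seq (letter n)) : {vspace 'cV[rat]_(n.*2)} :=
  <<[seq column a | a <- I]>>%VS.

Lemma columnE a : column a = Sp_rat M *m delta_mx (basis_index a) 0.
Proof. by rewrite -colE /column /Sp_rat map_col. Qed.

Fact apartment_subproof (I : simplices (dbeta n)) :
  isotropic (apartment_space I) && (apartment_space I != 0%VS).
Proof.
case: I => I /= /andP[/andP[_ /forallP std] I0]; apply/andP; split.
  have span u : u \in apartment_space I ->
    u = \sum_(i < size [seq column a | a <- I])
          coord (in_tuple [seq column a | a <- I]) i u *:
          [seq column a | a <- I]`_i.
    exact: (@coord_span _ _ _ (in_tuple [seq column a | a <- I])).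
  apply/asboolP => u v /span -> /span ->.
  rewrite omega_suml big1 // => i _; rewrite omegaZl linear_sum big1 ?mulr0 //.
  move=> j _; rewrite linearZ /=.
  have szI : size [seq column a | a <- I] = size I by rewrite size_map.
  have a0 : letter n by case: (I) I0.
  have iI : (i < size I)%N by rewrite -szI.
  have jI : (j < size I)%N by rewrite -szI.
  rewrite (nth_map a0) // (nth_map a0) // !columnE Sp_rat_omega omega_delta.
  have := mem_nth a0 iI; have := mem_nth a0 jI.
  case: (nth a0 I i) (nth a0 I j) => [k b] [l c] /= lI kI.
  case: eqP => [kl|_]; last by rewrite mulr0.
  have /negP := std k; rewrite -kl in lI.
  by case: b c kI lI => [] [] kI lI H; rewrite ?subrr ?mulr0 //;
    case: H; rewrite kI lI.
case: I I0 {std} => // a I _; apply: contraNneq (_ : column a != 0) => [E|].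
  by rewrite -memv0 -E memv_span // mem_head.
apply/eqP => E.
have : delta_mx (basis_index a) 0 = 0 :> 'cV[rat]_(n.*2).
  by rewrite -(mulKmx (Sp_rat_unit M) (delta_mx _ _)) -columnE E mulmx0.
by move/matrixP/(_ (basis_index a) 0); rewrite !mxE !eqxx.
Qed.

Definition apartment_map (I : simplices (dbeta n)) : Tits n :=
  MkTits (apartment_subproof I).

Lemma apartment_map_homo : {homo apartment_map : I J / (I <= J)%O}.
Proof.
move=> I J IJ; apply: sub_span => v /mapP[a aI ->]; apply: map_f.
by apply: mem_subseq aI.
Qed.

Definition apartment_class (xi0 : rH (dbeta 1) 0) : St n :=
  hmap _ _ (push apartment_map) (subdivision (fundamental_class xi0 n)).
End Apartment.

Definition apartment_classes n (xi0 : rH (dbeta 1) 0) : set (St n) :=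
  [set x | exists M : Sp n, x = apartment_class M xi0].
Arguments apartment_classes : clear implicits.

(* Main.v *)
Require Import Defs.
From HB Require Import structures.
From mathcomp Require Import all_boot all_order all_algebra.
From mathcomp Require Import perm finmap monalg.
From mathcomp Require Import boolp classical_sets.
From mathcomp Require Import ring zify.

Set Implicit Arguments.
Unset Strict Implicit.
Unset Printing Implicit Defensive.

Import Order.TTheory GRing.Theory Num.Theory.
Local Open Scope ring_scope.

(** The poset of nonzero isotropic subspaces has no chains of more than n
    elements, so the Steinberg module is the group of cycles z that are
    combinations of full flags of isotropic subspaces.  Sending a matrix M to
    its apartment class is equivariant by construction; all the work is to
    write every such cycle as an integral combination of the apartment cycles
    of integral symplectic bases ([apartments_generate]).  The proof is a
    Euclidean algorithm on the cycles themselves.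

    Let U_k be the span of the first k vectors e_1, ..., e_k of a symplectic
    basis M.  The statement proved by downward induction on k, [generated],
    concerns cycles of full flags above U_k: they are combinations of the links
    at U_1 < ... < U_k of apartments of symplectic bases starting with
    e_1, ..., e_k.  For k = n the only flag above the Lagrangian U_n is the
    empty one, and the link of the apartment of M at its own standard flag is
    1 times the empty flag: this is one coefficient of a barycentric
    subdivision ([link_apartment_n]).

    For the step, a cycle z above U_k is the sum over its heads L, of dimension
    k + 1, of L followed by the link of z at L, and these links are again cycles
    ([bd_link]).  A head has the form L = U_k + <v>, where v completes
    e_1, ..., e_k to a longer part of an integral symplectic basis
    ([frame_extend]); its height is |omega(v, f)| for the fixed vector
    f = e_(k+1) of M.  Let L have the largest height N > 0.  By induction the
    link of z at L comes from apartments of bases D through L.  Dividing with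
    remainder by N, one can shear D by multiples of v so that every other basis
    vector outside the first k pairs has height less than N ([frame_reduce]); this leaves the link at L
    unchanged because v lies in L ([link_apartment_shear]).  Subtracting the
    apartments of the sheared bases from z removes L and only creates heads of
    smaller height ([clear_head]).  In the end all heads have height 0, that
    is, lie in the orthogonal of f, and such a cycle vanishes
    ([perp_cycle_eq0]).

    The given generator of H_0 enters only at the end: the class used for the
    apartment chains is a multiple of it, hence so is the class of every
    apartment chain, and the apartment classes generate a fortiori
    ([apartment_class_multiple]). *)

(** * Links in chains of flags *)

Section Link.
Variable V : choiceType.
Implicit Types (ws s t : seq V) (c : {malg int[seq V]}).

(** Combinatorially, c is ws followed by its link at ws, plus flags that do not
    start with ws. *)
Definition link ws c : {malg int[seq V]} :=
  mlin (fun s => if prefix ws s then << drop (size ws) s >> else 0) c.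
HB.instance Definition _ ws := GRing.Additive.copy (link ws)
  (mlin (fun s => if prefix ws s then << drop (size ws) s >> else 0)).

Lemma link_simplex ws s :
  link ws << s >> = if prefix ws s then << drop (size ws) s >> else 0.
Proof. exact: mlin1. Qed.

Lemma mcoeff_link ws t c : (link ws c)@_t = c@_(ws ++ t).
Proof.
pose F := GRing.Additive.clone _ _ (mcoeff t \o link ws) _.
pose G := GRing.Additive.clone _ _ (mcoeff (ws ++ t) : {malg int[seq V]} -> int) _.
suff: F c = G c by [].
apply: additive_eq_in => s _ /=; rewrite link_simplex mcoeffU.
case: ifP => [/prefixP[s' ->]|ws_s].
  by rewrite drop_size_cat // mcoeffU eqseq_cat // eqxx.
by rewrite mcoeff0; case: eqP => // E; rewrite E prefix_prefix in ws_s.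
Qed.

Lemma msupp_link ws t c : (t \in msupp (link ws c)) = (ws ++ t \in msupp c).
Proof. by rewrite -!mcoeff_neq0 mcoeff_link. Qed.

Lemma link_cat ws ws' c : link (ws ++ ws') c = link ws' (link ws c).
Proof. by apply/malgP => t; rewrite !mcoeff_link catA. Qed.

Lemma link_nil c : link [::] c = c.
Proof. by apply/malgP => t; rewrite mcoeff_link. Qed.

(** On nonempty flags, the part of the boundary omitting the first vertex. *)
Definition tails c : {malg int[seq V]} := mlin (fun s => << behead s >>) c.
HB.instance Definition _ :=
  GRing.Additive.copy tails (mlin (fun s => << behead s >>)).

Lemma link_mcons w x c : link [:: w] (mcons x c) = if w == x then c else 0.
Proof.
case: eqP => [<-|/eqP wx].
  pose F := GRing.Additive.clone _ _ (link [:: w] \o mcons w) _.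
  suff: F c = (idfun : {additive {malg int[seq V]} -> _}) c by [].
  apply: additive_eq_in => s _ /=.
  by rewrite /mcons mlin1 link_simplex /= eqxx prefix0s drop0.
pose F := GRing.Additive.clone _ _ (link [:: w] \o mcons x) _.
suff: F c = (\0 : {additive _ -> {malg int[seq V]}}) c by [].
apply: additive_eq_in => s _ /=.
by rewrite /mcons mlin1 link_simplex /= (negPf wx).
Qed.

(** The face omitting the first vertex contributes the tails; the other
    faces of a flag starting with w still start with w, with opposite sign. *)
Lemma link_bd w c :
  link [:: w] (bd c) = link [:: w] (tails c) - bd (link [:: w] c).
Proof.
pose F := GRing.Additive.clone _ _ (link [:: w] \o bd) _.
pose G := GRing.Additive.clone _ _
  ((link [:: w] \o tails) \- (bd \o link [:: w])) _.
suff: F c = G c by [].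
apply: additive_eq_in => -[|x s] _ /=; rewrite bd_simplex link_simplex.
  by rewrite /bd1 big_ord0 /tails mlin1 /= link_simplex /= !raddf0 addr0.
rewrite bd1_cons raddfB /= /tails mlin1 /= link_mcons prefix0s andbT drop0.
by case: eqP => _; rewrite ?raddf0 ?bd_simplex.
Qed.

Lemma link_supp0 ws c : c \in supp_in (fun s => ~~ prefix ws s) -> link ws c = 0.
Proof.
move=> /supp_inP h; apply/malgP => t; rewrite mcoeff_link mcoeff0.
apply/eqP; rewrite mcoeff_eq0; apply/negP => /h.
by rewrite prefix_prefix.
Qed.

Lemma malg_eq0 c : (forall s, s \notin msupp c) -> c = 0.
Proof. by move=> h; apply/malgP => s; apply/eqP; rewrite mcoeff0 mcoeff_eq0. Qed.

Lemma malg_neq0 c : c <> 0 -> exists s, s \in msupp c.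
Proof.
move=> c0; apply: contrapT => h; apply: c0; apply: malg_eq0 => s.
by apply/negP => sc; apply: h; exists s.
Qed.

Lemma mcons_link w c : {in msupp c, forall s, prefix [:: w] s} ->
  c = mcons w (link [:: w] c).
Proof.
move=> h; pose F := GRing.Additive.clone _ _ (mcons w \o link [:: w]) _.
suff: (idfun : {additive {malg int[seq V]} -> _}) c = F c by [].
apply: additive_eq_in => s /h /prefixP[t ->] /=.
by rewrite link_simplex /= eqxx prefix0s drop0 /mcons mlin1.
Qed.
End Link.
Arguments tails {V} c.

(** * Integral symplectic bases *)

Section Frames.
Variable n : nat.
Implicit Types (a b c : letter n) (M C : Sp n).

Lemma omegaC (R : comNzRingType) (u v : 'cV[R]_(n.*2)) : omega u v = - omega v u.
Proof. by rewrite /omega -sumrN; apply: eq_bigr => i _; ring. Qed.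

Lemma omegaDl (R : comNzRingType) (u v w : 'cV[R]_(n.*2)) :
  omega (u + v) w = omega u w + omega v w.
Proof. by have := omega_is_linearl w 1 u v; rewrite !scale1r /= mul1r. Qed.

Lemma omegaDr (R : comNzRingType) (u v w : 'cV[R]_(n.*2)) :
  omega w (u + v) = omega w u + omega w v.
Proof. exact: linearD. Qed.

Lemma omegaZr (R : comNzRingType) k (u v : 'cV[R]_(n.*2)) :
  omega u (k *: v) = k * omega u v.
Proof. exact: linearZ. Qed.

Lemma omegauu (R : comNzRingType) (u : 'cV[R]_(n.*2)) : omega u u = 0.
Proof. by rewrite /omega big1 // => i _; ring. Qed.

Definition bar a : letter n := (a.1, ~~ a.2).

Lemma barK : involutive bar.
Proof. by case=> i b; rewrite /bar /= negbK. Qed.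

(** The Gram matrix of a symplectic basis indexed by letters. *)
Definition pairing (R : comNzRingType) a b : R :=
  if a.1 == b.1 then b.2%:R - a.2%:R else 0.

(** Up to sign, the bar letters index the dual basis: this is how coordinates
    in a symplectic basis are read off below. *)
Lemma pairing_bar (R : comNzRingType) a b : 
  pairing R a (bar b) = if a == b then (-1) ^+ b.2 else 0.
Proof.
case: a b => [i b] [j c]; rewrite /pairing -pair_eqE /=.
by case: (i == j) => //=; case: b; case: c;
  rewrite /= ?subrr ?subr0 ?sub0r ?expr0 ?expr1.
Qed.

Lemma basis_index_bij : bijective (@basis_index n).
Proof.
apply: inj_card_bij; first exact: basis_index_inj.
have := card_prod 'I_n bool; rewrite !card_ord card_bool muln2 => <-.
exact: leqnn.
Qed.

Lemma letterP (j : 'I_(n.*2)) : exists a, j = basis_index a.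
Proof. by case: basis_index_bij => g _ gK; exists (g j); rewrite gK. Qed.

Definition basis (R : comNzRingType) a : 'cV[R]_(n.*2) := delta_mx (basis_index a) 0.

Lemma omega_basisr (R : comNzRingType) (y : 'cV[R]_(n.*2)) a :
  omega y (basis R a) = (-1) ^+ (~~ a.2) * y (basis_index (bar a)) 0.
Proof.
rewrite /omega (bigD1 a.1) //= big1 => [|i ia].
  case: a => i [] /=; rewrite !mxE !(inj_eq (@basis_index_inj n)) -!pair_eqE /= eqxx /=;
  by rewrite ?expr0 ?expr1; ring.
by rewrite !mxE !(inj_eq (@basis_index_inj n)) /= -!pair_eqE /= (negPf ia) /=; ring.
Qed.

(** The integral form of [column], with which division is possible. *)
Definition icol M a : 'cV[int]_(n.*2) := col (basis_index a) M.

Lemma icolE M a : icol M a = M *m basis int a.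
Proof. by rewrite /icol colE. Qed.

Lemma omega_icol M a b : omega (icol M a) (icol M b) = pairing int a b.
Proof. by rewrite !icolE Sp_omega omega_delta. Qed.

Lemma omega_column M a b : omega (column M a) (column M b) = pairing rat a b.
Proof.
rewrite /column omega_map -!/(icol M _) omega_icol /pairing.
by case: ifP => _; rewrite ?rmorph0 // rmorphB /= !rmorph_nat.
Qed.

(** A family with the Gram matrix of a symplectic basis has an inverse matrix,
    given by the dual basis; so elements of Sp may be built one column at a time. *)
Lemma frame_Sp (F : letter n -> 'cV[int]_(n.*2)) :
  (forall a b, omega (F a) (F b) = pairing int a b) ->
  exists M, forall a, icol M a = F a.
Proof.
move=> FF; have [g bK gK] := basis_index_bij.
pose M : 'M[int]_(n.*2) := \matrix_(i, j) F (g j) i 0.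
have colM a : M *m basis int a = F a.
  by rewrite -colE; apply/matrixP => i k; rewrite !mxE bK (ord1 k).
have E (w : 'cV[int]_(n.*2)) : w = \sum_i w i 0 *: basis int (g i).
  rewrite {1}[w]matrix_sum_delta; apply: eq_bigr => i _.
  by rewrite big_ord1 /basis gK (ord1 0).
have MM u v : omega (M *m u) (M *m v) = omega u v.
  rewrite (E u) (E v) !mulmx_sumr !omega_suml; apply: eq_bigr => i _.
  rewrite -!scalemxAr !omegaZl !linear_sum; congr (_ * _).
  apply: eq_bigr => j _; rewrite -!scalemxAr !linearZ /=; congr (_ * _).
  by rewrite !colM FF omega_delta.
pose N : 'M[int]_(n.*2) := \matrix_(i, j)
  ((-1) ^+ (g i).2 * omega (basis int (g j)) (F (bar (g i)))).
have NM : N *m M = 1%:M.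
  apply/matrixP => i j; rewrite [in RHS]mxE mxE.
  transitivity ((-1) ^+ (g i).2 * omega (M *m basis int (g j)) (F (bar (g i)))).
    rewrite colM (E (F (g j))) omega_suml mulr_sumr; apply: eq_bigr => k _.
    by rewrite omegaZl !mxE; ring.
  rewrite colM FF pairing_bar -(inj_eq (can_inj gK)) eq_sym.
  by case: eqP => _; rewrite ?mulr0 // -expr2 sqrr_sign.
have sM : Defs.is_symplectic M.
  rewrite /Defs.is_symplectic; have [_ ->] := mulmx1_unit NM.
  by apply/asboolP.
by exists (MkSp sM) => a; rewrite icolE colM.
Qed.

(** Bases with the same vectors e_1, ..., e_k. *)
Definition agree (k : nat) M C :=
  forall i : 'I_n, (i < k)%N -> icol C (i, false) = icol M (i, false).

Lemma agree_trans k M1 M2 M3 : agree k M1 M2 -> agree k M2 M3 -> agree k M1 M3.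
Proof. by move=> h1 h2 i ik; rewrite h2 ?h1. Qed.

Lemma agreeW k l M C : (k <= l)%N -> agree l M C -> agree k M C.
Proof. by move=> kl h i ik; rewrite h // (leq_trans ik). Qed.

(** Exchanging the index of a with k, after turning (e, f) into (f, -e) at
    that index when a is barred, moves any remaining vector to the position
    of e_(k+1). *)
Lemma frame_swap M (k : 'I_n) a : (k <= a.1)%N ->
  exists2 C, agree k M C & icol C (k, false) = icol M a.
Proof.
case: a => [i e] /= ki.
pose F (c : letter n) : 'cV[int]_(n.*2) :=
  if (c.1 == k) && e then
    if c.2 then - icol M (i, false) else icol M (i, true)
  else icol M (tperm k i c.1, c.2).
have [|C CF] := frame_Sp (F := F).
  move=> [i1 b1] [i2 b2]; rewrite /F /pairing /=.
  case: e F; rewrite ?andbF ?andbT => F; last first.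
    by rewrite omega_icol /pairing /= (inj_eq perm_inj).
  have tk j : j != k -> (i == tperm k i j) = false.
    move=> jk; apply/negP => /eqP h; move/eqP: jk; apply.
    by apply: (@perm_inj _ (tperm k i)); rewrite tpermL.
  have tk' j : j != k -> (tperm k i j == i) = false.
    by move=> /tk; rewrite eq_sym.
  have [E1|i1k] := eqVneq i1 k; have [E2|i2k] := eqVneq i2 k.
  - rewrite E1 E2 eqxx.
    by case: b1; case: b2; rewrite -?[- icol _ _]scaleN1r ?omegaZl ?omegaZr
      omega_icol /pairing /= eqxx; ring.
  - rewrite E1 [k == i2]eq_sym (negPf i2k).
    by case: b1; rewrite -?[- icol _ _]scaleN1r ?omegaZl ?omegaZr
      omega_icol /pairing /= tk //; ring.
  - rewrite E2 (negPf i1k).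
    by case: b2; rewrite -?[- icol _ _]scaleN1r ?omegaZl ?omegaZr
      omega_icol /pairing /= tk' //; ring.
  - by rewrite omega_icol /pairing /= (inj_eq perm_inj).
exists C => [j jk|]; rewrite CF /F /=; last by rewrite eqxx tpermL; case: (e).
have jk' : (j == k) = false by apply/negP => /eqP E; rewrite E ltnn in jk.
rewrite jk' /= tpermD //; first by rewrite eq_sym jk'.
by apply/eqP => E; rewrite E leqNgt jk in ki.
Qed.

(** The linear map S differs from the identity by a combination of products
    in u and v; the quadratic terms vanish since u and v span an isotropic
    subspace.  It fixes v and moves the vectors orthogonal to v by multiples
    of v. *)
Lemma shear_omega (R : comNzRingType) (u v : 'cV[R]_(n.*2)) p :
  omega v u = 0 ->
  let S x := x + omega v x *: (u + p *: v) + omega u x *: v in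
  forall x y, omega (S x) (S y) = omega x y.
Proof.
move=> vu S x y.
rewrite /S !(omegaDl, omegaDr, omegaZl, omegaZr) !omegauu.
rewrite (omegaC u v) vu (omegaC x u) (omegaC x v); ring.
Qed.

(** Division with remainder for symplectic bases.  A shear along
    v = e_(k+1) adds multiples of v to the vectors of larger index, and these
    multiples can be prescribed through the choice of u; the vector f_(k+1) paired
    with v changes by u, and then by a multiple of v that is still free. *)
Lemma frame_reduce M (k : 'I_n) (f : 'cV[int]_(n.*2)) :
  let N := `|omega (icol M (k, false)) f|%N in (0 < N)%N ->
  exists C, [/\ agree k.+1 M C,
    forall a, (k < a.1)%N ->
      exists m : int, icol C a = icol M a + m *: icol M (k, false) &
    forall a, (k <= a.1)%N -> a != (k, false) -> (`|omega (icol C a) f| < N)%N].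
Proof.
set v := icol M (k, false) => N N0.
have vf0 : omega v f != 0 by rewrite -absz_gt0.
(* q x is the multiple of v that reduces the height of x modulo N. *)
pose q (x : 'cV[int]_(n.*2)) : int := - (omega x f %/ omega v f)%Z.
have qP x : (`|omega (x + q x *: v) f| < N)%N.
  rewrite omegaDl omegaZl /q mulNr {1}(divz_eq (omega x f) (omega v f)).
  rewrite addrAC subrr add0r.
  by rewrite -ltz_nat gez0_abs ?modz_ge0 // abszE ltz_mod.
have [g bK gK] := basis_index_bij.
(* The coordinates of u in M are chosen so that omega u takes the value q on
   the basis vectors of index larger than k. *)
pose y : 'cV[int]_(n.*2) := \col_j if (k < (g j).1)%N then
  (-1) ^+ (g j).2 * q (icol M (bar (g j))) else 0.
pose u : 'cV[int]_(n.*2) := M *m y.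
have omu a : omega u (icol M a) = if (k < a.1)%N then q (icol M a) else 0.
  rewrite icolE Sp_omega omega_basisr mxE bK /=.
  case: ifP => _; last by rewrite mulr0.
  by rewrite mulrA -expr2 sqrr_sign mul1r barK icolE.
have vu : omega v u = 0 by rewrite omegaC omu ltnn oppr0.
have omv a : omega v (icol M a) = if a == (k, true) then 1 else 0.
  case: a => i b; rewrite omega_icol /pairing -pair_eqE /= [i == k]eq_sym.
  by case: (k == i) => //; case: b; rewrite /= ?subr0.
(* w is the image of f_(k+1) before a multiple of v is added. *)
pose w := icol M (k, true) + u.
pose S x := x + omega v x *: (u + q w *: v) + omega u x *: v.
have [|C CF] := frame_Sp (F := fun a => S (icol M a)).
  by move=> a b; rewrite /S shear_omega // omega_icol.
exists C; split.
- move=> i ik; rewrite CF /S omv omu /= -pair_eqE /= andbF scale0r addr0.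
  by rewrite ltnNge -ltnS ik /= scale0r addr0.
- move=> a ka; exists (q (icol M a)); rewrite CF /S omu ka omv.
  suff -> : (a == (k, true)) = false by rewrite scale0r addr0.
  by apply/negP => /eqP E; rewrite E ltnn in ka.
move=> a ka akf; rewrite CF /S omv omu.
case: (eqVneq a (k, true)) => [->|akt].
  by rewrite /= ltnn scale0r addr0 scale1r addrA qP.
rewrite scale0r addr0 [(k < _)%N]ltn_neqAle ka andbT.
suff -> : (k != a.1 :> nat) by apply: qP.
apply/negP => /eqP/val_inj E; case: (a) E akf akt => i [] /= ->; by rewrite eqxx.
Qed.

(** Iterating [frame_reduce], with any remaining vector of nonzero height
    moved to position k, the heights decrease until a single one is nonzero. *)
Lemma frame_concentrate M (k : 'I_n) (f : 'cV[int]_(n.*2)) a : (k <= a.1)%N ->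
  omega (icol M a) f != 0 -> exists C, [/\ agree k M C,
    omega (icol C (k, false)) f != 0 &
    forall b, (k <= b.1)%N -> b != (k, false) -> omega (icol C b) f = 0].
Proof.
move eN: `|omega (icol M a) f|%N => N.
elim/ltn_ind: N => N IHN in M a eN *; move=> ka af.
have [C0 MC0 C0a] := frame_swap M ka.
have N0 : (0 < N)%N by rewrite -eN absz_gt0.
have := @frame_reduce C0 k f; rewrite /= C0a eN => /(_ N0) [C [C1 _ C2]].
have MC : agree k M C by apply: agree_trans MC0 (agreeW _ C1).
have [[b [kb bk bf]]|nob] := pselect (exists b, [/\ (k <= b.1)%N, b != (k, false) &
    omega (icol C b) f != 0]).
  have [C' [h1 h2 h3]] := IHN _ (C2 b kb bk) C b erefl kb bf.
  by exists C'; split=> //; apply: agree_trans h1.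
exists C; split=> //; first by rewrite C1 ?C0a.
move=> b kb bk; apply/eqP; apply: contra_notT nob => bf.
by exists b.
Qed.
End Frames.

(** * Spans of basis vectors and isotropic subspaces *)

Section Subspaces.
Variable n : nat.
Local Notation E := 'cV[rat]_(n.*2).
Implicit Types (a b c : letter n) (M C : Sp n) (U W : {vspace E}) (J : seq (letter n)).

Lemma dim_add_line U (v : E) : v \notin U -> \dim (U + <[v]>) = (\dim U).+1.
Proof.
move=> vU; rewrite dimv_disjoint_sum ?dim_vline; last first.
  apply/eqP; rewrite -subv0; apply/subvP => x /memv_capP[xU /vlineP[k E]].
  rewrite E memv0; apply: contraNT vU => kv0.
  have k0 : k != 0 by apply: contraNneq kv0 => ->; rewrite scale0r.
  by rewrite -[v](scalerK k0) -E memvZ.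
suff -> : v != 0 by rewrite addn1.
by apply: contraNneq vU => ->; rewrite mem0v.
Qed.

Lemma omega_apartment M J (w : E) :
  (forall a, a \in J -> omega (column M a) w = 0) ->
  forall x, x \in apartment_space M J -> omega x w = 0.
Proof.
move=> h x /(@coord_span _ _ _ (in_tuple [seq column M a | a <- J])) ->.
rewrite omega_suml big1 // => i _; rewrite omegaZl.
have /mapP[a aJ ->] : (in_tuple [seq column M a | a <- J])`_i \in
    [seq column M a | a <- J] by apply: mem_nth.
by rewrite h ?mulr0.
Qed.

(** Membership in a coordinate subspace is tested with the dual basis. *)
Lemma mem_apartmentP M J (x : E) : 
  reflect (forall a, a \notin J -> omega x (column M (bar a)) = 0)
          (x \in apartment_space M J).
Proof.
apply: (iffP idP) => [xJ a aJ|h].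
  apply: omega_apartment xJ => b bJ; rewrite omega_column pairing_bar.
  by case: eqP => // ba; rewrite ba (negPf aJ) in bJ.
pose y := invmx (Sp_rat M) *m x.
have xE : x = Sp_rat M *m y by rewrite mulKVmx ?Sp_rat_unit.
rewrite {}xE [y]matrix_sum_delta mulmx_sumr memv_suml // => i _.
rewrite big_ord1 (ord1 0) -scalemxAr; have [a ->] := letterP i.
have [aJ|/h] := boolP (a \in J).
  by rewrite memvZ // -columnE memv_span // map_f.
rewrite columnE -[x](mulKVmx (Sp_rat_unit M)) Sp_rat_omega.
rewrite omega_basisr barK => /eqP; rewrite mulf_eq0 signr_eq0 /= => /eqP ->.
by rewrite scale0r mem0v.
Qed.

Lemma mem_column M J a : (column M a \in apartment_space M J) = (a \in J).
Proof.
apply/idP/idP => [/mem_apartmentP h|aJ]; last by rewrite memv_span // map_f.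
apply: contraT => /h; rewrite omega_column pairing_bar eqxx => /eqP.
by rewrite signr_eq0.
Qed.

Definition first_letters k : seq (letter n) :=
  [seq ((i, false) : letter n) | i : 'I_n <- enum 'I_n & (i < k)%N].

Lemma mem_first_letters k a : (a \in first_letters k) = ~~ a.2 && (a.1 < k)%N.
Proof.
apply/mapP/idP => [[i]|]; first by rewrite mem_filter => /andP[ik _] ->.
by case: a => i [] //= ik; exists i; rewrite // mem_filter ik mem_enum.
Qed.

(** The space U_k of the introduction. *)
Definition flag_space M k := apartment_space M (first_letters k).

Lemma flag_space0 M : flag_space M 0 = 0%VS.
Proof.
rewrite /flag_space /first_letters /apartment_space; under eq_filter do rewrite ltn0.
by rewrite filter_pred0 /= span_nil.
Qed.

Lemma flag_spaceS M (k : 'I_n) : 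
  flag_space M k.+1 = (flag_space M k + <[column M (k, false)]>)%VS.
Proof.
apply/eqP; rewrite eqEsubv subv_add; apply/and3P; split.
- apply/span_subvP => v /mapP[a]; rewrite mem_first_letters => /andP[a2 ak] ->.
  case: a a2 ak => i [] //= _; rewrite ltnS leq_eqVlt => /orP[/eqP/val_inj->|ik].
    by rewrite (subvP (addvSr _ _)) ?memv_line.
  by rewrite (subvP (addvSl _ _)) // mem_column mem_first_letters.
- apply: sub_span => v /mapP[a]; rewrite mem_first_letters => /andP[a2 ak] ->.
  by apply: map_f; rewrite mem_first_letters a2 ltnW.
- by rewrite -memvE mem_column mem_first_letters /=.
Qed.

Lemma dim_flag_space M k : (k <= n)%N -> \dim (flag_space M k) = k.
Proof.
elim: k => [|k IHk] kn; first by rewrite flag_space0 dimv0.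
rewrite (flag_spaceS M (Ordinal kn)) dim_add_line ?IHk 1?ltnW //.
by rewrite mem_column mem_first_letters /= ltnn.
Qed.

Lemma column_agree k M C (i : 'I_n) : agree k M C -> (i < k)%N ->
  column C (i, false) = column M (i, false).
Proof. by move=> h ik; rewrite /column -!/(icol _ _) h. Qed.

Lemma flag_space_agree k M C : agree k M C -> flag_space C k = flag_space M k.
Proof.
move=> MC; congr span; apply/eq_in_map => a; rewrite mem_first_letters.
by case: a => i [] //= ik; apply: column_agree MC _.
Qed.

Lemma isotropic_flag_space M k x y : x \in flag_space M k -> y \in flag_space M k ->
  omega x y = 0.
Proof.
move=> xU yU; apply: omega_apartment xU => a ak; rewrite omegaC.
rewrite (omega_apartment (M := M) (J := first_letters k)) ?oppr0 // => b bk.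
rewrite omega_column /pairing; move: ak bk; rewrite !mem_first_letters.
by move=> /andP[/negPf aF _] /andP[/negPf bF _]; rewrite aF bF subrr if_same.
Qed.

Lemma clear_denominators m (v : 'cV[rat]_m) :
  exists2 d : int, d != 0 & exists f : 'cV[int]_m, map_mx intr f = d%:~R *: v.
Proof.
pose d := \prod_(i < m) denq (v i 0).
exists d; first by apply/prodf_neq0 => i _; rewrite denq_eq0.
exists (\col_i (numq (v i 0) * \prod_(j < m | j != i) denq (v j 0))).
apply/matrixP => i k; rewrite !mxE (ord1 k) [in RHS]/d [in RHS](bigD1 i) //=.
by rewrite !intrM numqE; ring.
Qed.

(** An integral multiple of v pairs with the basis vectors outside U_k; after
    [frame_concentrate] only one of these pairings is nonzero, so v is modulo
    U_k a multiple of one basis vector, which [frame_swap] moves to the position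
    of e_(k+1). *)
Lemma frame_extend M k (v : E) :
  (forall i : 'I_n, (i < k)%N -> omega v (column M (i, false)) = 0) ->
  v \notin flag_space M k -> (k < n)%N /\
  exists2 C, agree k M C & flag_space C k.+1 = (flag_space M k + <[v]>)%VS.
Proof.
move=> vM vU.
have [a [ka av]] : exists a, (k <= a.1)%N /\ omega v (column M a) != 0.
  apply: contrapT => h; move/negP: vU; apply; apply/mem_apartmentP => a.
  rewrite mem_first_letters => ak; apply/eqP; apply: contra_notT h => av.
  exists (bar a); split; last exact: av.
  rewrite leqNgt; apply: contra ak => ik; rewrite ik andbT.
  apply: contra av => a2; apply/eqP.
  have -> : bar a = (a.1, false) by rewrite /bar a2.
  exact: vM.
have kn : (k < n)%N by apply: leq_ltn_trans ka (ltn_ord _).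
split=> //; have [d d0 [f fE]] := clear_denominators v.
have omf C c : (omega (icol C c) f)%:~R = d%:~R * omega (column C c) v :> rat.
  by rewrite -omega_map fE omegaZr.
have d0' : d%:~R != 0 :> rat by rewrite intr_eq0.
have [|C [MC Ck Cz]] := @frame_concentrate n M (Ordinal kn) f a ka.
  by rewrite -(intr_eq0 rat) omf mulf_neq0 // omegaC oppr_eq0.
have [|C' CC' C'k] := @frame_swap n C (Ordinal kn) (Ordinal kn, true).
  exact: leqnn.
have MC' : agree k M C' := agree_trans MC CC'.
exists C'; first exact: MC'.
apply/esym/eqP; rewrite eqEdim (dim_add_line vU) (dim_flag_space _ kn).
rewrite (dim_flag_space _ (ltnW kn)) leqnn andbT (flag_spaceS C' (Ordinal kn)).
rewrite (flag_space_agree MC') subv_add addvSl /=.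
have -> : column C' (Ordinal kn, false) = column C (Ordinal kn, true).
  by rewrite /column -!/(icol _ _) C'k.
rewrite -(flag_space_agree MC) -memvE addvC.
have -> : (<[column C (Ordinal kn, true)]> + flag_space C k)%VS =
    apartment_space C ((Ordinal kn, true) :: first_letters k).
  by rewrite /apartment_space /= span_cons.
apply/mem_apartmentP => b; rewrite inE negb_or mem_first_letters => /andP[bk bl].
rewrite omegaC; apply/eqP; rewrite oppr_eq0.
have [kb|bk'] := leqP k b.1.
  rewrite -(mulrI_eq0 _ (lregP d0')) -omf intr_eq0 Cz //.
  by rewrite -(inj_eq (can_inj (@barK n))) barK.
have b2 : b.2 by move: bl; rewrite bk' andbT negbK.
have -> : bar b = (b.1, false) by rewrite /bar b2.
by rewrite (column_agree MC) // omegaC vM // oppr0.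
Qed.

(** A maximal U_k inside W is W, since otherwise [frame_extend] enlarges it. *)
Lemma isotropic_frame W : isotropic W ->
  exists M k, (k <= n)%N /\ W = flag_space M k.
Proof.
move=> /asboolP iW.
suff H m M k : (k <= n)%N -> (flag_space M k <= W)%VS -> (\dim W = k + m)%N ->
    exists M k, (k <= n)%N /\ W = flag_space M k.
  by apply: (H (\dim W) (Sp1 n) 0%N); rewrite ?flag_space0 ?sub0v ?add0n.
elim: m M k => [|m IHm] M k kn UW dW.
  exists M, k; split=> //; apply/esym/eqP; rewrite eqEdim UW dW addn0 /=.
  by rewrite dim_flag_space ?leqnn.
have /subvPn[v vW vU] : ~~ (W <= flag_space M k)%VS.
  by apply/negP => /dimvS; rewrite dim_flag_space // dW addnS ltnNge leq_addr.
have [|kn' [C MC CE]] := @frame_extend M k v _ vU.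
  move=> i ik; apply: iW => //; apply: (subvP UW).
  by rewrite mem_column mem_first_letters.
apply: (IHm C k.+1) => //; last by rewrite dW addSnnS.
by rewrite CE subv_add UW -memvE.
Qed.

Lemma isotropic_dim W : isotropic W -> (\dim W <= n)%N.
Proof. by move=> /isotropic_frame[M [k [kn ->]]]; rewrite dim_flag_space. Qed.
End Subspaces.

(** * Cycles of full flags *)

Section Flags.
Variable n : nat.
Local Notation E := 'cV[rat]_(n.*2).
Implicit Types (U : {vspace E}) (W L : Tits n) (z : {malg int[seq (Tits n)]}).

(** Flags that start just above U, in which every dimension up to n occurs. *)
Fixpoint full_flag U (s : seq (Tits n)) : bool :=
  if s is W :: s' then [&& (U <= W)%VS, \dim W == (\dim U).+1 & full_flag W s']
  else \dim U == n.

Lemma Tits_isotropic W x y :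
  x \in (W : {vspace E}) -> y \in (W : {vspace E}) -> omega x y = 0.
Proof. by have /andP[/asboolP iW _] := valP W; apply: iW. Qed.

Lemma Tits_dim W : (\dim W <= n)%N.
Proof. by have /andP[iW _] := valP W; apply: isotropic_dim. Qed.

Lemma Tits_dim_gt0 W : (0 < \dim W)%N.
Proof. by have /andP[_ W0] := valP W; rewrite lt0n dimv_eq0. Qed.

Lemma lt_Tits W L : (W < L)%O -> (W <= L)%VS && (\dim W < \dim L)%N.
Proof.
rewrite lt_def => /andP[LW WL]; have WL' : (W <= L)%VS by [].
rewrite WL' ltnNge; apply: contra LW => dLW; apply/eqP/val_inj/esym/eqP.
by rewrite eqEdim WL'.
Qed.

Lemma path_dim W s : path <%O W s -> (size s + \dim W <= n)%N.
Proof.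
elim: s W => [|L s IHs] W /=; first by rewrite add0n Tits_dim.
move=> /andP[/lt_Tits/andP[_ dWL] /IHs]; apply: leq_trans.
by rewrite addSnnS leq_add2l.
Qed.

(** A chain of n subspaces whose dimensions lie between 1 and n skips none. *)
Lemma sorted_full_flag s : sorted <%O s -> size s = n -> full_flag 0%VS s.
Proof.
suff H U : (forall W, W \in s -> (U <= W)%VS && (\dim U < \dim W)%N) ->
    sorted <%O s -> (size s + \dim U)%N = n -> full_flag U s.
  move=> ss sn; apply: H => //; last by rewrite dimv0 addn0.
  by move=> W _; rewrite sub0v dimv0 Tits_dim_gt0.
elim: s U => [|W s IHs] U h ss sn /=; first exact/eqP.
have /andP[UW dUW] := h W (mem_head _ _).
have dW := path_dim ss.
have dWE : \dim W = (\dim U).+1 by move: sn dW dUW => /=; lia.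
rewrite UW dWE eqxx /=; apply: IHs; last by move: sn; rewrite dWE addnS.
  move=> L Ls; apply: lt_Tits; move: ss; rewrite /= lt_path_sortedE.
  by move=> /andP[/allP h' _]; apply: h'.
exact: path_sorted ss.
Qed.

Lemma full_flag_cat U ws L t : full_flag U (ws ++ L :: t) -> full_flag L t.
Proof. by elim: ws U => [|W ws IHs] U /= /and3P[_ _] //; apply: IHs. Qed.

Lemma full_flag_link U L z :
  z \in supp_in (full_flag U) -> link [:: L] z \in supp_in (full_flag L).
Proof.
move=> /supp_inP h; apply/supp_inP => t; rewrite msupp_link => /h.
exact: (@full_flag_cat U [::]).
Qed.

(** In a full flag the second space has dimension two more than U, so it
    cannot be a head. *)
Lemma link_tails U L z : z \in supp_in (full_flag U) -> \dim L = (\dim U).+1 ->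
  link [:: L] (tails z) = 0.
Proof.
move=> /supp_inP zU dL; apply/link_supp0/mlin_supp_in => s /zU.
case: s => [|W [|W' s]] h; rewrite supp_inU //=.
move: h => /= /and5P[_ /eqP dW _ /eqP dW' _].
by apply/nandP; left; apply/eqP => E; move: dW'; rewrite -E dL dW => /n_Sn.
Qed.

Lemma link_dim U L z : z \in supp_in (full_flag U) -> \dim L != (\dim U).+1 ->
  link [:: L] z = 0.
Proof.
move=> /supp_inP zU dL; apply/link_supp0/supp_inP => -[//|W s] /zU /and3P[_ dW _] /=.
by apply/nandP; left; apply: contraNneq dL => ->.
Qed.

Lemma bd_link U L z :
  z \in supp_in (full_flag U) -> bd z = 0 -> bd (link [:: L] z) = 0.
Proof.
move=> zU bz; have [dL|dL] := eqVneq (\dim L) (\dim U).+1.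
  have := link_bd L z; rewrite bz raddf0 (link_tails zU dL) sub0r.
  by move/eqP; rewrite eq_sym oppr_eq0 => /eqP.
by rewrite (link_dim zU dL) raddf0.
Qed.

(** Otherwise adding f gives an isotropic subspace of dimension n + 1. *)
Lemma lagrangian_perp U (f : E) : isotropic U -> \dim U = n ->
  (forall u, u \in U -> omega u f = 0) -> f \in U.
Proof.
move=> /asboolP iU dU Uf; apply: contraT => fU.
suff /isotropic_dim : isotropic (U + <[f]>) by rewrite dim_add_line // dU ltnn.
apply/asboolP => x y /memv_addP[u uU [_ /vlineP[a ->] ->]].
move=> /memv_addP[v vU [w /vlineP[b ->] ->]].
rewrite !(omegaDl, omegaDr, omegaZl, omegaZr) (iU _ _ uU vU) (Uf _ uU).
by rewrite (omegaC f) (Uf _ vU) omegauu oppr0 !mulr0 !addr0.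
Qed.

(** Induction on the codimension of U in a Lagrangian.  If a head L does
    not contain f, then its link is again a cycle whose heads M are orthogonal
    to f: for M not orthogonal to f the face of L < M < ... omitting L could only
    cancel against a flag W < M < ... with another head W; but W is
    orthogonal to f, hence so is L + W = M.  So the link at L vanishes by induction,
    and the only possible head is U + <f>.  The boundary of a cycle with
    a single head contains the link at this head, which is therefore 0. *)
Lemma perp_cycle_eq0 m U z (f : E) : isotropic U -> (\dim U + m)%N = n ->
  (forall u, u \in U -> omega u f = 0) -> f \notin U ->
  z \in supp_in (full_flag U) -> bd z = 0 ->
  (forall L t, L :: t \in msupp z ->
    forall x, x \in (L : {vspace E}) -> omega x f = 0) ->
  z = 0.
Proof.
elim: m U z => [|m IHm] U z iU dU Uf fU zU bz zf.
  by rewrite addn0 in dU; rewrite lagrangian_perp in fU.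
have zU' := elimT (supp_inP _ _) zU.
have heads L t : L :: t \in msupp z -> (U <= L)%VS /\ \dim L = (\dim U).+1.
  by move=> /zU' /and3P[UL /eqP].
have claim1 L t : L :: t \in msupp z -> f \in (L : {vspace E}).
  move=> Lt; apply: contraT => fL; have [UL dL] := heads _ _ Lt.
  have lz : link [:: L] z = 0.
    apply: IHm fL (full_flag_link _ zU) (bd_link _ zU bz) _.
    - by have /andP[] := valP L.
    - by rewrite dL addSnnS.
    - exact: zf Lt.
    move=> M s; rewrite msupp_link /= => LMs x xM; apply/eqP; apply: contraT => xf.
    have := zU' _ LMs => /= /and5P[_ _ LM /eqP dM _].
    (* Only flags with head L have M as their second space. *)
    have : link [:: M] (tails z) = link [:: M] (link [:: L] z).
      pose F := GRing.Additive.clone _ _ (link [:: M] \o tails) _.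
      pose G := GRing.Additive.clone _ _ (link [:: M] \o link [:: L]) _.
      suff: F z = G z by [].
      apply: additive_eq_in => -[/zU' /=|W s' sz].
        by move/eqP; lia.
      rewrite /= /tails mlin1 /= (link_simplex [:: L]) /= prefix0s andbT drop0.
      have [//|LW] := eqVneq L W.
      rewrite raddf0 link_simplex; case: s' sz => [//|M' s'] sz /=.
      have [MM'|//] := eqVneq M M'; rewrite -MM' in sz.
      have := zU' _ sz => /= /and5P[_ /eqP dW WM _ _].
      have LWM : (L + W <= M)%VS by rewrite subv_add LM WM.
      have LWE : (L + W)%VS == M.
        rewrite eqEdim LWM dM ltnNge; apply: contra LW => dLW.
        have LE : (L : {vspace E}) == (L + W)%VS by rewrite eqEdim addvSl.
        have WL : (W <= L)%VS by rewrite (eqP LE) addvSr.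
        by apply/eqP/val_inj/esym/eqP; rewrite /= eqEdim WL dL dW leqnn.
      move: xM; rewrite -(eqP LWE) => /memv_addP[y yL [y' yW E]].
      move: xf; rewrite E omegaDl (zf _ _ Lt y yL) (zf _ _ sz y' yW).
      by rewrite addr0 eqxx.
    have lM : link [:: M] z = 0.
      by apply: link_dim zU _; rewrite dM dL eqn_leq ltnn.
    have := link_bd M z; rewrite lM bz !raddf0 addr0 => <-.
    move=> /(congr1 (mcoeff s)); rewrite mcoeff0 !mcoeff_link /=.
    by move=> /esym/eqP; rewrite mcoeff_eq0 LMs.
  have : t \in msupp (link [:: L] z) by rewrite msupp_link.
  by rewrite lz msupp0 in_fset0.
apply: contrapT => /malg_neq0[[/zU' /=|L t Lt]].
  by move/eqP; lia.
have [UL dL] := heads _ _ Lt.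
have LE : (U + <[f]>)%VS == L.
  by rewrite eqEdim subv_add UL -memvE (claim1 _ _ Lt) dim_add_line // dL leqnn.
have zE : z = mcons L (link [:: L] z).
  apply: mcons_link => -[/zU' /=|W s Ws].
    by move/eqP; lia.
  rewrite /= prefix0s andbT; have [UW dW] := heads _ _ Ws.
  apply/eqP/val_inj; transitivity (U + <[f]>)%VS; first exact/esym/eqP.
  apply/eqP; rewrite eqEdim subv_add UW -memvE (claim1 _ _ Ws).
  by rewrite dim_add_line // dW leqnn.
(* As z is L followed by a cycle, its boundary is this cycle. *)
have bL := bd_link L zU bz.
have L0 : link [:: L] z = 0 by move: bz; rewrite {1}zE bd_mcons bL raddf0 subr0.
have : t \in msupp (link [:: L] z) by rewrite msupp_link.
by rewrite L0 msupp0 in_fset0.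
Qed.
End Flags.

(** * A coefficient of the barycentric subdivision *)

Section SubdivisionCoefficients.
Variables (d : Order.disp_t) (V : porderType d) (K : complex V).

Lemma mcoeffMz (T : choiceType) (c : {malg int[T]}) z t : (c *~ z)@_t = c@_t *~ z.
Proof. exact: (raddfMz (mcoeff t)). Qed.

Lemma mcoeff_mrcons (T : choiceType) (x y : T) s (c : {malg int[seq T]}) :
  (mrcons x c)@_(rcons s y) = if x == y then c@_s else 0.
Proof.
pose F := GRing.Additive.clone _ _ (mcoeff (rcons s y) \o mrcons x) _.
have H z : F << z >> = (rcons z x == rcons s y)%:R.
  by rewrite /= /mrcons mlin1 mcoeffU.
case: eqP => [xy|/eqP xy].
  pose G := GRing.Additive.clone _ _ (mcoeff s : {malg int[seq T]} -> int) _.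
  suff: F c = G c by [].
  by apply: additive_eq_in => z _; rewrite H eqseq_rcons xy eqxx andbT /= mcoeffU.
suff: F c = (\0 : {additive _ -> int}) c by [].
by apply: additive_eq_in => z _; rewrite H eqseq_rcons (negPf xy) andbF.
Qed.

Definition prefixes (s : seq V) := [seq take j.+1 s | j <- iota 0 (size s)].

Lemma prefixes_rcons s x : prefixes (rcons s x) = rcons (prefixes s) (rcons s x).
Proof.
rewrite /prefixes size_rcons -addn1 iotaD map_cat /= cats1; congr rcons.
  apply/eq_in_map => j; rewrite mem_iota /= add0n => js.
  by rewrite -cats1 takel_cat.
by rewrite take_oversize ?size_rcons.
Qed.

(** The largest vertex of a flag of faces is the barycenter of the simplex
    itself, so only the simplex s contributes to the flag of prefixes of s; in the
    recursion the sign of the subdivision cancels the sign of the last face. *)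
Lemma mcoeff_sd_rec (ws : seq (simplices K)) s :
  map (@vertices _ _ K) ws = prefixes s ->
  forall t, K t -> size t = size s -> (sd_rec K (size t) t)@_ws = (t == s)%:R.
Proof.
elim/last_ind: s ws => [|s x IHs] ws.
  by case: ws => // _ t _ /size0nil ->; rewrite /= mcoeffUU.
case/lastP: ws => [/(congr1 size)|ws b]; first by rewrite prefixes_rcons size_rcons.
rewrite map_rcons prefixes_rcons => /rcons_inj[wsE bE] t Kt.
rewrite size_rcons => st; rewrite st /=.
case: insubP => [b0 _ b0E|]; last by rewrite Kt -size_eq0 st.
rewrite mcoeffMz mcoeff_mrcons.
have -> : (b0 == b) = (t == rcons s x).
  by rewrite -(inj_eq val_inj) b0E -bE.
case: eqP => [tE|_]; last by rewrite mul0rz.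
rewrite {}tE in Kt st *.
have xs : x \notin s.
  have := simplex_sorted Kt; rewrite (sorted_pairwise lt_trans) => /(pairwise_uniq ltxx).
  by rewrite rcons_uniq => /andP[].
have -> : (mlin (sd_rec K (size s)) (bd1 (rcons s x)))@_ws = (bd1 (rcons s x))@_s.
  pose F := GRing.Additive.clone _ _ (mcoeff ws \o mlin (sd_rec K (size s))) _.
  pose G := GRing.Additive.clone _ _ (mcoeff s : {malg int[seq V]} -> int) _.
  suff: F (bd1 (rcons s x)) = G (bd1 (rcons s x)) by [].
  apply: additive_eq_in => t' /(supp_inP _ _ (bd1_supp _)) /andP[t's].
  rewrite size_rcons /= => /eqP t'z; rewrite mlin1 mcoeffU -t'z.
  by apply: IHs => //; apply: simplex_subseq t's Kt.
rewrite bd1_rcons mcoeffD mcoeffMz mcoeffUU (_ : (mrcons x (bd1 s))@_s = 0).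
  by rewrite add0r -mulrzA -exprD addnn -mul2n exprM sqrrN expr1n.
apply/eqP; rewrite mcoeff_eq0; apply/negP.
have : mrcons x (bd1 s) \in supp_in (fun t : seq V => x \in t).
  by apply: mlin_supp_in => u _; apply: supp_inU; rewrite mem_rcons mem_head.
by move=> /supp_inP h /h; rewrite (negPf xs).
Qed.

Lemma mcoeff_sd (ws : seq (simplices K)) s c :
  map (@vertices _ _ K) ws = prefixes s -> c \in chains K (size s) ->
  (sd K c)@_ws = c@_s.
Proof.
move=> wsE /supp_inP cK.
pose F := GRing.Additive.clone _ _ (mcoeff ws \o sd K) _.
pose G := GRing.Additive.clone _ _ (mcoeff s : {malg int[seq V]} -> int) _.
suff: F c = G c by [].
apply: additive_eq_in => t /cK /andP[Kt /eqP ts].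
by rewrite /= /sd mlin1 mcoeffU (mcoeff_sd_rec wsE).
Qed.
End SubdivisionCoefficients.

Section Push.
Variables (d d' : Order.disp_t) (P : porderType d) (Q : porderType d').
Variable f : P -> Q.

Lemma push_uniq s : injective f -> uniq s -> push f << s >> = << map f s >>.
Proof. by move=> fi us; rewrite /push mlin1 map_inj_uniq ?us. Qed.

Lemma prefix_map ws s : injective f -> prefix (map f ws) (map f s) = prefix ws s.
Proof. by move=> fi; rewrite !prefixE size_map -map_take inj_eq //; apply: inj_map. Qed.

Lemma link_push ws c : injective f -> c \in supp_in uniq ->
  link (map f ws) (push f c) = push f (link ws c).
Proof.
move=> fi /supp_inP uc.
pose F := GRing.Additive.clone _ _ (link (map f ws) \o push f) _.
pose G := GRing.Additive.clone _ _ (push f \o link ws) _.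
suff: F c = G c by [].
apply: additive_eq_in => s /uc us /=.
rewrite push_uniq // !link_simplex prefix_map //.
by case: ifP => _; rewrite ?raddf0 // push_uniq ?drop_uniq // size_map map_drop.
Qed.

Lemma push_supp c t : t \in msupp (push f c) -> exists2 s, s \in msupp c & t = map f s.
Proof.
have : push f c \in supp_in (fun t => `[< exists2 s, s \in msupp c & t = map f s >]).
  apply: mlin_supp_in => s sc; case: ifP => _; last exact: rpred0.
  by apply: supp_inU; apply/asboolP; exists s.
by move=> /supp_inP h /h /asboolP.
Qed.
End Push.

Section Beta.
(** The fundamental cycle of the cross-polytope; in dimension -1 it is the
    empty simplex, so that the suspension of it is the difference of two points. *)
Fixpoint beta n : {malg int[seq (letter n)]} :=
  if n is m.+1 then susp (beta m) else << [::] >>.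

Definition unbarred n : seq (letter n) :=
  [seq ((i, false) : letter n) | i <- enum 'I_n].

Lemma size_unbarred n : size (unbarred n) = n.
Proof. by rewrite size_map size_enum_ord. Qed.

Lemma beta_chain n : beta n \in chains (dbeta n) n /\ bd (beta n) = 0.
Proof.
elim: n => [|n [IH1 IH2]].
  split; last by rewrite bd_simplex /bd1 big_ord0.
  by apply: supp_inU; rewrite /= andbT; apply/forallP => -[].
have [h1 h2] := susp_chain_map IH1.
by split; [exact: h1 | rewrite h2 IH2 raddf0].
Qed.

Lemma unbarredS n : unbarred n.+1 = join_letter false (unbarred n).
Proof.
rewrite /unbarred /join_letter enum_ordSr map_rcons -!map_comp; congr rcons.
Qed.

Lemma mcoeff_susp n (c : {malg int[seq (letter n)]}) s :
  (susp c)@_(join_letter false s) = c@_s.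
Proof.
pose F := GRing.Additive.clone _ _ (mcoeff (join_letter false s) \o @susp n) _.
pose G := GRing.Additive.clone _ _ (mcoeff s : {malg int[seq (letter n)]} -> int) _.
suff: F c = G c by [].
apply: additive_eq_in => t _; rewrite /= /susp mlin1 mcoeffB !mcoeffU.
rewrite /join_letter !eqseq_rcons -!pair_eqE /= eqxx andbF andbT subr0.
by rewrite (inj_eq (inj_map (@widen_letter_inj n))).
Qed.

Lemma mcoeff_beta n : (beta n)@_(unbarred n) = 1.
Proof.
elim: n => [|n IHn]; last by rewrite unbarredS mcoeff_susp.
by rewrite /= (size0nil (size_unbarred 0)) mcoeffUU.
Qed.
End Beta.

(** * Apartment cycles and their links *)

Section ApartmentChain.
Variable n : nat.
Hypothesis n_gt0 : (0 < n)%N.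
Local Notation E := 'cV[rat]_(n.*2).
Implicit Types (a b : letter n) (M C D : Sp n) (I J : simplices (dbeta n)).

Lemma first_letters_take k : (k <= n)%N -> first_letters n k = take k (unbarred n).
Proof.
move=> kn; rewrite /first_letters /unbarred -map_take; congr map.
apply: (inj_map val_inj); rewrite map_take val_enum_ord take_iota (minn_idPl kn).
by rewrite -(filter_iota_ltn 0 kn) -val_enum_ord filter_map.
Qed.

Lemma unbarred_simplex : dbeta n (unbarred n).
Proof.
have /supp_inP/(_ (unbarred n)) := (beta_chain n).1.
by rewrite -mcoeff_neq0 mcoeff_beta => /(_ isT) /andP[].
Qed.

Fact first_simplex_subproof k :
  dbeta n (first_letters n k.+1) && (first_letters n k.+1 != [::]).
Proof.
have h : (Ordinal n_gt0, false) \in first_letters n k.+1 by rewrite mem_first_letters.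
have -> : first_letters n k.+1 != [::] by apply: contraTneq h => ->.
rewrite andbT; apply: simplex_subseq unbarred_simplex.
by apply: map_subseq; apply: filter_subseq.
Qed.

Definition first_simplex k : simplices (dbeta n) :=
  Simplices (first_simplex_subproof k).

Lemma vertices_first_simplex :
  [seq vertices J | J <- [seq first_simplex j | j <- iota 0 n]] =
  prefixes (unbarred n).
Proof.
rewrite /prefixes size_unbarred -map_comp; apply/eq_in_map => j.
by rewrite mem_iota /= => jn; rewrite first_letters_take.
Qed.

Definition flag_prefix M k : seq (Tits n) :=
  [seq apartment_map M (first_simplex j) | j <- iota 0 k].

Lemma flag_prefixS M k :
  flag_prefix M k.+1 = rcons (flag_prefix M k) (apartment_map M (first_simplex k)).
Proof. by rewrite /flag_prefix -addn1 iotaD map_cat cats1. Qed.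

Lemma flag_prefixE M k :
  flag_prefix M k = map (apartment_map M) (map first_simplex (iota 0 k)).
Proof. by rewrite -map_comp. Qed.

Lemma flag_prefix_agree k M C : agree k M C -> flag_prefix C k = flag_prefix M k.
Proof.
move=> MC; apply/eq_in_map => j; rewrite mem_iota /= => jk; apply: val_inj => /=.
exact: flag_space_agree (agreeW jk MC).
Qed.

Lemma simplices_mem_inj I J : vertices I =i vertices J -> I = J.
Proof.
move=> IJ; apply: val_inj; apply: (irr_sorted_eq lt_trans ltxx) => //.
  by have /andP[/simplex_sorted] := valP I.
by have /andP[/simplex_sorted] := valP J.
Qed.

Lemma apartment_map_inj M : injective (apartment_map M).
Proof.
move=> I J /(congr1 val) /= IJ; apply: simplices_mem_inj => a.
by rewrite -!(mem_column M) IJ.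
Qed.

Lemma standard_bar J a : a \in vertices J -> bar a \notin vertices J.
Proof.
have /andP[/andP[_ /forallP std] _] := valP J.
by case: a => i b aJ; apply: contra (std i) => bJ; case: b aJ bJ => [] -> ->.
Qed.

Definition sphere := sd (dbeta n) (beta n).

Lemma sphere_chain : sphere \in chains (order_complex (simplices (dbeta n))) n /\
  bd sphere = 0.
Proof.
have [b1 b2] := beta_chain n; have [h1 h2] := sd_chain_map b1.
by split; [exact: h1 | rewrite h2 b2 raddf0].
Qed.

Lemma sphere_uniq : sphere \in supp_in uniq.
Proof.
apply/supp_inP => s /(supp_inP _ _ sphere_chain.1) /andP[/= ss _].
by move: ss; rewrite lt_sorted_uniq_le => /andP[].
Qed.

Definition apartment_chain M := push (apartment_map M) sphere.

Lemma apartment_chain_cycle M :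
  apartment_chain M \in chains (order_complex (Tits n)) n /\
  bd (apartment_chain M) = 0.
Proof.
have [s1 s2] := sphere_chain.
have [h1 h2] := push_chain_map (@apartment_map_homo n M) s1.
by split; [exact: h1 | rewrite h2 s2 raddf0].
Qed.

Lemma apartment_chain_full M : apartment_chain M \in supp_in (full_flag 0%VS).
Proof.
apply/supp_inP => s /(supp_inP _ _ (apartment_chain_cycle M).1) /andP[/= ss /eqP sz].
exact: sorted_full_flag.
Qed.

Lemma full_flag_prefix M k t : (k <= n)%N ->
  full_flag 0%VS (flag_prefix M k ++ t) -> full_flag (flag_space M k) t.
Proof.
case: k => [|k] kn; first by rewrite flag_space0.
rewrite flag_prefixS cat_rcons; exact: full_flag_cat.
Qed.

Lemma link_apartment_chain M C k : agree k M C ->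
  link (flag_prefix M k) (apartment_chain C) =
  push (apartment_map C) (link (map first_simplex (iota 0 k)) sphere).
Proof.
move=> MC; rewrite -(flag_prefix_agree MC) flag_prefixE link_push //.
  exact: apartment_map_inj.
exact: sphere_uniq.
Qed.

Lemma link_apartment_full M C k : (k <= n)%N -> agree k M C ->
  link (flag_prefix M k) (apartment_chain C) \in supp_in (full_flag (flag_space M k)).
Proof.
move=> kn MC; apply/supp_inP => t.
rewrite msupp_link => /(supp_inP _ _ (apartment_chain_full C)).
exact: full_flag_prefix.
Qed.

Lemma bd_link_apartment M C k : (k <= n)%N -> agree k M C ->
  bd (link (flag_prefix M k) (apartment_chain C)) = 0.
Proof.
elim: k => [|k IHk] kn MC; first by rewrite link_nil (apartment_chain_cycle C).2.
have MC' := agreeW (leqnSn k) MC.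
rewrite flag_prefixS -cats1 link_cat (bd_link _ (link_apartment_full (ltnW kn) MC')) //.
exact: IHk (ltnW kn) MC'.
Qed.

(** A full flag is the standard flag of M exactly when it comes from the flag of
    prefixes of the simplex {1, ..., n}, which has coefficient 1. *)
Lemma link_apartment_n M : link (flag_prefix M n) (apartment_chain M) = << [::] >>.
Proof.
rewrite link_apartment_chain //.
have -> : link (map first_simplex (iota 0 n)) sphere = << [::] >>.
  apply/malgP => t; rewrite mcoeff_link mcoeffU; case: t => [|J t].
    rewrite cats0 eqxx (mcoeff_sd vertices_first_simplex) ?mcoeff_beta //.
    by rewrite size_unbarred (beta_chain n).1.
  apply/eqP; rewrite mcoeff_eq0; apply/negP => /(supp_inP _ _ sphere_chain.1) /andP[_].
  by rewrite size_cat !size_map size_iota -[X in _ == X]addn0 eqn_add2l.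
by rewrite push_uniq //; apply: apartment_map_inj.
Qed.

(** All spaces of an apartment are spanned by basis vectors, and a standard
    simplex containing 1, ..., k only has further letters of larger index. *)
Lemma head_link_apartment M C k L t : (k <= n)%N -> agree k M C ->
  L :: t \in msupp (link (flag_prefix M k) (apartment_chain C)) ->
  exists a, (k <= a.1)%N /\ (L : {vspace E}) = (flag_space M k + <[column C a]>)%VS.
Proof.
move=> kn MC Lt; have := supp_inP _ _ (link_apartment_full kn MC) _ Lt.
move: Lt; rewrite msupp_link => /push_supp[s _ /(congr1 (fun s => L \in s))].
rewrite mem_cat mem_head orbT => /esym/mapP[J _ ->] /= /and3P[UJ /eqP dJ _] {L t s}.
have kJ a : a \in first_letters n k -> a \in vertices J.
  by move=> ak; rewrite -(mem_column C) (subvP UJ) // -(flag_space_agree MC) mem_column.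
have [a [aJ ak]] : exists a, a \in vertices J /\ a \notin first_letters n k.
  apply: contrapT => h; have : (apartment_space C J <= flag_space M k)%VS.
    rewrite -(flag_space_agree MC); apply: sub_span => _ /mapP[a aJ ->]; apply: map_f.
    by apply: contrapT => /negP ak; apply: h; exists a.
  by move/dimvS; rewrite dJ ltnn.
exists a; split; last first.
  apply/esym/eqP; rewrite eqEdim subv_add UJ -memvE mem_column aJ dJ /=.
  by rewrite dim_add_line // -(flag_space_agree MC) mem_column.
rewrite leqNgt; apply/negP => ak'; move: ak.
rewrite mem_first_letters ak' andbT negbK => a2.
by have := standard_bar aJ; rewrite kJ // mem_first_letters /= ak' a2.
Qed.

(** Multiples of a basis vector in the span may be added to the others. *)
Lemma apartment_shear_sub C D (k : 'I_n) J : agree k.+1 C D ->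
  (forall a, (k < a.1)%N ->
    exists m : int, icol D a = icol C a + m *: icol C (k, false)) ->
  {subset first_letters n k.+1 <= vertices J} ->
  (apartment_space D J <= apartment_space C J)%VS.
Proof.
move=> CD h kJ; apply/span_subvP => _ /mapP[a aJ ->].
have [ak|ka] := leqP a.1 k.
  have a2 : a.2 = false.
    apply: contraTF (aJ) => a2; rewrite -(barK a); apply: standard_bar.
    by apply: kJ; rewrite mem_first_letters /= a2.
  case: a ak a2 aJ => i b /= ak -> aJ.
  by rewrite (column_agree CD) // mem_column.
have [m aE] := h a ka.
have -> : column D a = column C a + m%:~R *: column C (k, false).
  by rewrite /column -!/(icol _ _) aE map_mxD map_mxZ.
rewrite memvD ?memvZ ?mem_column //.
by apply: kJ; rewrite mem_first_letters /=.
Qed.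

(** The flags in the link lie above U_(k+1), which contains the vector whose
    multiples are added. *)
Lemma link_apartment_shear C D (k : 'I_n) : agree k.+1 C D ->
  (forall a, (k < a.1)%N ->
    exists m : int, icol D a = icol C a + m *: icol C (k, false)) ->
  link (flag_prefix C k.+1) (apartment_chain D) =
  link (flag_prefix C k.+1) (apartment_chain C).
Proof.
move=> CD h; rewrite !link_apartment_chain //; apply: additive_eq_in => t.
rewrite msupp_link => /(supp_inP _ _ sphere_chain.1) /andP[ss _].
suff tE : map (apartment_map D) t = map (apartment_map C) t.
  by rewrite /= /push !mlin1 tE.
apply/eq_in_map => J Jt; apply: val_inj => /=.
have kJ : {subset first_letters n k.+1 <= vertices J}.
  have iotaS : iota 0 k.+1 = rcons (iota 0 k) k by rewrite -addn1 iotaD cats1.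
  move: ss; rewrite iotaS map_rcons cat_rcons /=.
  move=> /(subseq_sorted lt_trans (suffix_subseq _ _)).
  rewrite /= lt_path_sortedE => /andP[/allP /(_ J Jt) /ltW kJ _].
  by apply: mem_subseq kJ.
have DC : agree k.+1 D C by move=> i ik; rewrite CD.
apply/eqP; rewrite eqEsubv; apply/andP; split.
  exact: apartment_shear_sub CD h kJ.
apply: apartment_shear_sub DC _ kJ => a ka; have [m aE] := h a ka.
by exists (- m); rewrite aE CD // scaleNr addrK.
Qed.
End ApartmentChain.

(** * The Euclidean algorithm on cycles *)

Section Generation.
Variable n : nat.
Hypothesis n_gt0 : (0 < n)%N.
Local Notation E := 'cV[rat]_(n.*2).
Implicit Types (M C D : Sp n) (L : Tits n) (z : {malg int[seq (Tits n)]}).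

Local Notation flag_prefix := (flag_prefix n_gt0).

(** The combinations of apartments are recorded as elements of the group
    ring, to match the source of the map in the theorem. *)
Definition spanned k M z := exists2 x : {malg int[Sp n]},
  x \in supp_in (fun C => `[< agree k M C >]) &
  z = mlin (fun C => link (flag_prefix M k) (apartment_chain C)) x.

Lemma spanned0 k M : spanned k M 0.
Proof. by exists 0; rewrite ?rpred0 ?raddf0. Qed.

Lemma spannedD k M z1 z2 : spanned k M z1 -> spanned k M z2 -> spanned k M (z1 + z2).
Proof.
move=> [x1 h1 ->] [x2 h2 ->]; exists (x1 + x2); first by rewrite rpredD.
by rewrite raddfD.
Qed.

Definition relative_cycle k M z :=
  z \in supp_in (full_flag (flag_space M k)) /\ bd z = 0.

Lemma spanned_cycle k M z : (k <= n)%N -> spanned k M z -> relative_cycle k M z.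
Proof.
move=> kn [x /supp_inP hx ->]; split.
  by apply: mlin_supp_in => C /hx /asboolP; apply: link_apartment_full.
pose F := GRing.Additive.clone _ _
  (bd \o mlin (fun C => link (flag_prefix M k) (apartment_chain C))) _.
suff: F x = (\0 : {additive {malg int[Sp n]} -> {malg int[seq (Tits n)]}}) x by [].
apply: additive_eq_in => C /hx /asboolP MC /=.
by rewrite mlin1 bd_link_apartment.
Qed.

Definition generated k := forall M z, relative_cycle k M z -> spanned k M z.

Section Height.
Variables (k : 'I_n) (M : Sp n) (f : 'cV[int]_(n.*2)).

(** A head may lie on many bases; it is enough to bound the height in one
    of them. *)
Definition height_le N L := exists2 C, agree k M C &
  (L : {vspace E}) = flag_space C k.+1 /\ (`|omega (icol C (k, false)) f| <= N)%N.

Lemma height_leW N N' L : (N <= N')%N -> height_le N L -> height_le N' L.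
Proof.
by move=> NN' [C MC [LE h]]; exists C => //; split=> //; apply: leq_trans NN'.
Qed.

Lemma head_frame C L t : agree k M C ->
  L :: t \in msupp (link (flag_prefix M k) (apartment_chain C)) ->
  (L : {vspace E}) = flag_space C k.+1 \/
  exists a : letter n, [/\ (k <= a.1)%N, a != (k, false) &
    exists2 D, agree k M D &
      (L : {vspace E}) = flag_space D k.+1 /\ icol D (k, false) = icol C a].
Proof.
move=> MC /(head_link_apartment (ltnW (ltn_ord k)) MC) [a [ka LE]].
have [ak|ak] := eqVneq a (k, false); [left | right].
  by rewrite LE ak flag_spaceS (flag_space_agree MC).
exists a; split=> //; have [D CD Da] := frame_swap C ka.
have MD : agree k M D := agree_trans MC CD.
exists D => //; split=> //; rewrite LE flag_spaceS (flag_space_agree MD).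
congr (_ + <[_]>)%VS.
by rewrite /column -!/(icol _ _) Da.
Qed.

(** The combination y is the one given for the link at L by the induction
    hypothesis, with every basis D in it replaced by its reduction. *)
Lemma clear_head N C L z : generated k.+1 -> relative_cycle k M z -> agree k M C ->
  (L : {vspace E}) = flag_space C k.+1 -> `|omega (icol C (k, false)) f|%N = N.+1 ->
  exists y, [/\ spanned k M y, link [:: L] y = link [:: L] z &
    forall L' t, L' :: t \in msupp y -> L' = L \/ height_le N L'].
Proof.
move=> gen [zU bz] MC LE CN.
have [|x /supp_inP hx lzE] := gen C (link [:: L] z).
  by split; [rewrite -LE; apply: full_flag_link zU | apply: bd_link zU bz].
have prefixL : flag_prefix C k.+1 = flag_prefix M k ++ [:: L].
  rewrite flag_prefixS (flag_prefix_agree _ MC) -cats1; congr (_ ++ [:: _]).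
  by apply: val_inj; rewrite /= LE.
pose reduced D D' := agree k.+1 C D -> [/\ agree k.+1 D D',
  forall a : letter n, (k < a.1)%N ->
    exists m : int, icol D' a = icol D a + m *: icol D (k, false) &
  forall a : letter n, (k <= a.1)%N -> a != (k, false) ->
    (`|omega (icol D' a) f| <= N)%N].
have [|g gP] := boolp.choice (P := reduced).
  move=> D; have [CD|nCD] := pselect (agree k.+1 C D); last by exists D.
  have := @frame_reduce n D k f; rewrite /= CD // CN => /(_ isT) [D' [h1 h2 h3]].
  by exists D'; split=> // a ka; have := h2 a ka; rewrite CD.
pose x' := mlin (fun D => << g D >> : {malg int[Sp n]}) x.
have MgD D : agree k.+1 C D -> agree k M (g D).
  move=> CD; apply: agree_trans MC _; apply: agreeW (leqnSn k) _.
  by apply: agree_trans (CD) _; have [] := gP D CD.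
pose y := mlin (fun D => link (flag_prefix M k) (apartment_chain (g D))) x.
have yE : y = mlin (fun C => link (flag_prefix M k) (apartment_chain C)) x'.
  pose F := GRing.Additive.clone _ _
    ((mlin (fun C => link (flag_prefix M k) (apartment_chain C))) \o
     mlin (fun D => << g D >> : {malg int[Sp n]})) _.
  suff: mlin (fun D => link (flag_prefix M k) (apartment_chain (g D))) x = F x by [].
  by apply: additive_eq_in => D _; rewrite /= !mlin1.
exists y; split.
- exists x' => //; apply: mlin_supp_in => D /hx /asboolP CD.
  by apply: supp_inU; apply/asboolP; apply: MgD.
- rewrite lzE; pose F := GRing.Additive.clone _ _ (link [:: L] \o
    mlin (fun D => link (flag_prefix M k) (apartment_chain (g D)))) _.
  suff: F x = mlin (fun C' => link (flag_prefix C k.+1) (apartment_chain C')) x.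
    by [].
  apply: additive_eq_in => D /hx /asboolP CD; rewrite /= !mlin1 -link_cat -prefixL.
  have [h1 h2 _] := gP D CD.
  by rewrite -(flag_prefix_agree _ CD); apply: link_apartment_shear.
have : y \in supp_in (fun s =>
    `[< forall L' t, s = L' :: t -> L' = L \/ height_le N L' >]).
  apply: mlin_supp_in => D /hx /asboolP CD; apply/supp_inP => s sD.
  apply/asboolP => L' t sE; rewrite {}sE in sD.
  have [h1 _ h3] := gP D CD.
  case: (head_frame (MgD D CD) sD) => [L'E|[a [ka ak [D' MD' [L'E D'a]]]]]; [left|right].
    by apply: val_inj; rewrite /= L'E LE (flag_space_agree h1) (flag_space_agree CD).
  by exists D' => //; split=> //; rewrite D'a; apply: h3.
by move=> /supp_inP hy L' t /hy /asboolP; apply.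
Qed.

(** The finitely many heads of height N + 1 are cleared one by one; the list
    r contains those that may remain. *)
Lemma spanned_height_step N : generated k.+1 ->
  (forall z, relative_cycle k M z ->
    (forall L t, L :: t \in msupp z -> height_le N L) -> spanned k M z) ->
  forall z, relative_cycle k M z ->
    (forall L t, L :: t \in msupp z -> height_le N.+1 L) -> spanned k M z.
Proof.
move=> gen IHN.
suff H (r : seq (Tits n)) z : relative_cycle k M z ->
    (forall L t, L :: t \in msupp z ->
      height_le N L \/ L \in r /\ height_le N.+1 L) ->
    spanned k M z.
  move=> z zc zN; apply: (H (pmap ohead (msupp z)) z zc) => L t Lt; right.
  split; last exact: zN Lt.
  by rewrite mem_pmap; apply/mapP; exists (L :: t).
elim: r z => [|L r IHr] z zc zN.
  by apply: IHN => // L t /zN [//|[]].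
have [[LN NL]|nL] := pselect (height_le N.+1 L /\ ~ height_le N L); last first.
  apply: IHr => // L' t /zN [h|[]]; [by left | rewrite inE => /orP[/eqP ->|]].
    move=> h; left; apply: contrapT => h'; exact: nL.
  by move=> *; right.
have [C MC [LE CN]] := LN.
have {}CN : `|omega (icol C (k, false)) f|%N = N.+1.
  apply/eqP; rewrite eqn_leq CN /= ltnNge; apply/negP => h.
  by apply: NL; exists C.
have [y [ys yL yN]] := clear_head gen zc MC LE CN.
have [yU by0] := spanned_cycle (ltnW (ltn_ord k)) ys.
rewrite -(subrK y z); apply: spannedD (ys); apply: IHr.
  by split; [rewrite rpredB // ?zc.1 | rewrite raddfB /= zc.2 by0 subrr].
move=> L' t Lt.
have LL' : L' <> L.
  move=> E; rewrite E in Lt.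
  have : t \in msupp (link [:: L] (z - y)) by rewrite msupp_link.
  by rewrite raddfB /= yL subrr msupp0 in_fset0.
have /fsetUP[/zN|/yN] := fsubsetP (msuppB_le _ _) _ Lt.
  by move=> [h|[]]; [left | rewrite inE => /orP[/eqP//|]; right].
by move=> [//|]; left.
Qed.
End Height.

Lemma uniform_bound (T : eqType) (P : nat -> T -> Prop) (s : seq T) :
  (forall N N' x, (N <= N')%N -> P N x -> P N' x) ->
  (forall x, x \in s -> exists N, P N x) -> exists N, forall x, x \in s -> P N x.
Proof.
move=> mono; elim: s => [|x s IHs] h; first by exists 0%N.
have [N1 h1] := h x (mem_head _ _).
have [|N2 h2] := IHs; first by move=> y ys; apply: h; rewrite inE ys orbT.
exists (maxn N1 N2) => y; rewrite inE => /orP[/eqP ->|/h2].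
  exact: mono (leq_maxl _ _) h1.
exact: mono (leq_maxr _ _).
Qed.

Lemma height_le_exists (k : 'I_n) M f L : (flag_space M k <= L)%VS -> \dim L = k.+1 ->
  exists N, height_le k M f N L.
Proof.
move=> UL dL.
have /subvPn[v vL vU] : ~~ (L <= flag_space M k)%VS.
  by apply/negP => /dimvS; rewrite dim_flag_space ?dL ?ltnn // ltnW.
have [|_ [C MC CE]] := @frame_extend n M k v _ vU.
  move=> i ik; apply: (Tits_isotropic (W := L)) => //.
  by rewrite (subvP UL) // mem_column mem_first_letters.
exists `|omega (icol C (k, false)) f|%N, C => //; split=> //.
apply/esym/eqP; rewrite CE eqEdim subv_add UL -memvE vL dL dim_add_line //.
by rewrite dim_flag_space ?leqnn 1?ltnW.
Qed.

Lemma generated_step (k : 'I_n) : generated k.+1 -> generated k.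
Proof.
move=> gen M z zc; pose f := icol M (k, false).
have kn := ltnW (ltn_ord k).
have zU := elimT (supp_inP _ _) zc.1.
have [N zN] : exists N, forall s, s \in msupp z ->
    (forall L t, s = L :: t -> height_le k M f N L).
  apply: (uniform_bound
    (P := fun N s => forall L t, s = L :: t -> height_le k M f N L)).
    by move=> N N' s NN' h L t /h; apply: height_leW.
  move=> [|L t] sz; first by exists 0%N.
  have /and3P[UL /eqP dL _] := zU _ sz.
  have [|N NL] := @height_le_exists k M f L UL; first by rewrite dL dim_flag_space.
  by exists N => L' t' [<- _].
have {}zN L t : L :: t \in msupp z -> height_le k M f N L by move=> /zN; apply.
(* Induction on a bound of the heights of the heads of z. *)
elim: N z zc zN {zU} => [|N IHN] z zc zN; last first.
  by apply: spanned_height_step gen IHN _ zc zN.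
suff -> : z = 0 by apply: spanned0.
apply: (@perp_cycle_eq0 n (n - k) (flag_space M k) z (column M (k, false))).
- by apply/asboolP => u v; apply: isotropic_flag_space.
- by rewrite dim_flag_space // subnKC.
- move=> u uU; apply: (@isotropic_flag_space n M k.+1); last first.
    by rewrite mem_column mem_first_letters /=.
  by rewrite flag_spaceS (subvP (addvSl _ _)).
- by rewrite mem_column mem_first_letters /= ltnn.
- exact: zc.1.
- exact: zc.2.
move=> L t /zN [C MC [-> C0]]; apply: omega_apartment => -[i b].
rewrite mem_first_letters /= ltnS leq_eqVlt => /andP[/negPf -> /orP[/eqP/val_inj->|ik]].
  rewrite /column omega_map -!/(icol _ _).
  by move: C0; rewrite leqn0 absz_eq0 => /eqP ->.
by rewrite (column_agree MC) // omega_column /pairing subrr if_same.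
Qed.

Lemma generated_n : generated n.
Proof.
move=> M z [/supp_inP zU _]; have E s : s \in msupp z -> s = [::].
  case: s => // L t /zU /and3P[_ /eqP dL _].
  by have := Tits_dim L; rewrite dL dim_flag_space // ltnn.
exists (<< z@_[::] *g M >>); first by apply: supp_inU; apply/asboolP.
rewrite mlinU link_apartment_n -malgU_int; apply/malgP => s; rewrite mcoeffU.
case: eqP => [<-|sN]; first by rewrite mulr1n.
by apply/eqP; rewrite mulr0n mcoeff_eq0; apply/negP => /E /esym.
Qed.

Lemma apartments_generate z : z \in cycles (order_complex (Tits n)) n.-1 ->
  exists x : {malg int[Sp n]}, z = mlin (@apartment_chain n) x.
Proof.
have gen k : (k <= n)%N -> generated (n - k).
  elim: k => [|k IHk] kn; first by rewrite subn0; apply: generated_n.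
  have nk : (n - k.+1 < n)%N by rewrite ltn_subrL n_gt0.
  apply: (@generated_step (Ordinal nk)) => /=.
  by rewrite -subSn //; apply: IHk; apply: ltnW.
rewrite unfold_in (prednK n_gt0) => /andP[/supp_inP zc /eqP bz].
have := gen n (leqnn n); rewrite subnn => /(_ (Sp1 n) z) [|x _ ->].
  split=> //; apply/supp_inP => s /zc /andP[/= ss /eqP sz].
  by rewrite flag_space0; apply: sorted_full_flag.
exists x; apply: additive_eq_in => C _ /=; rewrite !mlin1.
exact: link_nil.
Qed.
End Generation.

(** * Passing to homology classes *)

Section Homology.
Variables (d : Order.disp_t) (V : porderType d) (K : complex V) (k : nat).

(** On cycles the class map is a morphism; [hclass], defined on all chains, is
    not. *)
Definition class_of (z : cycle_group K k) : rH K k :=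
  \pi_(Quotient.quot (boundaries (K := K) (k := k)))%qT z.
Lemma class_of_additive : zmod_morphism class_of.
Proof. by move=> x y; rewrite /class_of; exact: raddfB. Qed.
HB.instance Definition _ := GRing.isZmodMorphism.Build _ _ class_of class_of_additive.

Lemma hclassE (z : cycle_group K k) : hclass K k (val z) = class_of z.
Proof. by rewrite /hclass valKd. Qed.

Lemma hclass_ex (x : rH K k) : exists z : cycle_group K k, x = class_of z.
Proof. by exists (repr x); rewrite /class_of reprK. Qed.
End Homology.

Section InducedMap.
Variables (d d' : Order.disp_t) (V : porderType d) (W : porderType d').
Variables (K : complex V) (L : complex W) (r k : nat).
Variable F : {additive {malg int[seq V]} -> {malg int[seq W]}}.
Hypothesis cF : chain_map K L r F.

Lemma cycles_map c : c \in cycles K k -> F c \in cycles L (r + k)%N.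
Proof.
case/andP=> /cF[Fz bFz] /eqP bz.
by rewrite unfold_in -addnS Fz bFz bz raddf0 /=.
Qed.

Lemma hmap_additive : zmod_morphism (hmap L (r + k)%N F : rH K k -> rH L (r + k)%N).
Proof.
move=> x y; have [[a ->] [b ->]] := (hclass_ex x, hclass_ex y).
have H (c : cycle_group K k) :
    hmap L (r + k)%N F (class_of c) = class_of (CycleGroup (cycles_map (valP c))).
  by rewrite -hclassE hmap_hclass ?(valP c) // -hclassE.
rewrite -raddfB !H -raddfB; congr class_of; apply: val_inj => /=.
by rewrite raddfB.
Qed.

Lemma hmapMz (x : rH K k) m : hmap L (r + k)%N F (x *~ m) = hmap L (r + k)%N F x *~ m.
Proof.
pose H : {additive rH K k -> rH L (r + k)%N} := HB.pack
  (hmap L (r + k)%N F : rH K k -> rH L (r + k)%N)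
  (GRing.isZmodMorphism.Build _ _ _ hmap_additive).
exact: (raddfMz H).
Qed.
End InducedMap.

Section ActionOnApartments.
Variable n : nat.
Implicit Types (g M : Sp n).

Lemma act_Tits_inj g : injective (act_Tits g).
Proof.
have sub (U W : {vspace 'cV[rat]_(n.*2)}) : act_space g U = act_space g W -> (U <= W)%VS.
  move=> UW; apply/subvP => u uU.
  have : linfun (mulmx (Sp_rat g)) u \in act_space g U by apply: memv_img.
  rewrite UW => /memv_imgP[w wW]; rewrite !lfunE /= => uw.
  by rewrite -(mulKmx (Sp_rat_unit g) u) uw mulKmx ?Sp_rat_unit.
move=> U W /(congr1 val) /= UW; apply/val_inj/eqP.
by rewrite eqEsubv !sub.
Qed.

Lemma act_apartment_map g M I :
  act_Tits g (apartment_map M I) = apartment_map (g * M)%g I.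
Proof.
apply: val_inj; rewrite /= /act_space /apartment_space limg_span -map_comp.
congr span; apply: eq_map => a /=.
by rewrite lfunE /= !columnE mulmxA /Sp_rat -map_mxM.
Qed.

Lemma push_act_apartment g M c :
  push (act_Tits g) (push (apartment_map M) c) = push (apartment_map (g * M)%g) c.
Proof.
pose F := GRing.Additive.clone _ _ (push (act_Tits g) \o push (apartment_map M)) _.
suff: F c = push (apartment_map (g * M)%g) c by [].
apply: additive_eq_in => s _; rewrite /= /push !mlin1.
have -> : map (apartment_map (g * M)%g) s = map (act_Tits g) (map (apartment_map M) s).
  by rewrite -map_comp; apply: eq_map => I /=; rewrite act_apartment_map.
rewrite (map_inj_uniq (@act_Tits_inj g)).
by case: ifP => us; rewrite ?raddf0 // mlin1 (map_inj_uniq (@act_Tits_inj g)) us.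
Qed.

Variable xi0 : rH (dbeta 1) 0.

Lemma act_apartment_class g M :
  act_St g (apartment_class M xi0) = apartment_class (g * M)%g xi0.
Proof.
rewrite /act_St /apartment_class.
have [z ->] := hclass_ex (subdivision (fundamental_class xi0 n)).
have cM := push_chain_map (@apartment_map_homo n M).
have cgM := push_chain_map (@apartment_map_homo n (g * M)%g).
have cg := push_chain_map (@act_Tits_homo n g).
rewrite -hclassE.
have E1 := hmap_hclass cM (valP z); have E2 := hmap_hclass cgM (valP z).
have E3 := hmap_hclass cg (cycles_map cM (valP z)).
rewrite /= -push_act_apartment in E2.
by rewrite [RHS]E2 -[RHS]E3; congr hmap; apply: E1.
Qed.

Hypothesis xi0_fund : is_fundamental xi0.
Hypothesis n_gt0 : (0 < n)%N.

Lemma beta_cycle m : beta m.+1 \in cycles (dbeta m.+1) m.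
Proof. by have [h1 h2] := beta_chain m.+1; rewrite unfold_in h1 h2 /=. Qed.

(** The integer m expresses the class of the standard 0-cycle as a
    multiple of the generator xi0; suspension, subdivision and apartment maps are
    additive, so the same m works in every dimension. *)
Lemma apartment_class_multiple : exists m : int, forall M,
  apartment_class M xi0 *~ m = hclass (order_complex (Tits n)) n.-1 (apartment_chain M).
Proof.
have [m mE] := xi0_fund (hclass (dbeta 1) 0 (beta 1)); exists m => M.
have xiE j : hclass (dbeta j.+1) j (beta j.+1) = xi xi0 j *~ m.
  elim: j => [//|j IHj]; rewrite [xi _ _]/=.
  have := hmapMz (@susp_chain_map j.+1) (xi xi0 j) m; rewrite -IHj => <-.
  exact/esym/(hmap_hclass (@susp_chain_map j.+1) (beta_cycle j)).
move: M; case: (n) n_gt0 => // j _ M.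
have cs := @sd_chain_map _ _ (dbeta j.+1).
have cM := push_chain_map (@apartment_map_homo j.+1 M).
rewrite /apartment_class /subdivision [fundamental_class _ _]/=.
rewrite -[LHS](hmapMz cM) -[X in hmap _ _ _ X](hmapMz cs) -xiE.
have E1 := hmap_hclass cs (beta_cycle j).
have E2 := hmap_hclass cM (cycles_map cs (beta_cycle j)).
rewrite -[RHS]E2; congr hmap; exact: E1.
Qed.
End ActionOnApartments.

Lemma act_St_additive n (g : Sp n) : zmod_morphism (act_St g).
Proof. exact: (hmap_additive (push_chain_map (@act_Tits_homo n g))). Qed.
HB.instance Definition _ n (g : Sp n) :=
  GRing.isZmodMorphism.Build _ _ (act_St g) (act_St_additive g).

Theorem theorem1p1 (xi0 : rH (dbeta 1) 0) (xi0_fund : is_fundamental xi0)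
    (n : nat) (n_gt0 : (0 < n)%N) :
  exists phi : {additive {malg int[Sp n]} -> St n},
    [/\ forall (g : Sp n) (x : {malg int[Sp n]}),
          phi (lmulg g x) = act_St g (phi x),
        forall y : St n, exists x : {malg int[Sp n]}, phi x = y
      & [set y : St n | exists M : Sp n, y = phi << M >>]%classic =
        apartment_classes n xi0].
Proof.
pose phi := GRing.Additive.clone _ _ (mlin (fun M : Sp n => apartment_class M xi0)) _.
have phi1 M : phi << M >> = apartment_class M xi0 by rewrite /= mlin1.
exists phi; split.
- move=> g x.
  pose F := GRing.Additive.clone _ _ (phi \o mlin (fun h : Sp n => << (g * h)%g >>)) _.
  pose G := GRing.Additive.clone _ _ (act_St g \o phi) _.
  suff: F x = G x by [].
  apply: additive_eq_in => M _.
  transitivity (phi << (g * M)%g >>); first by congr (phi _); exact: mlin1.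
  by rewrite phi1 -act_apartment_class -phi1.
- move=> y; have [z ->] := hclass_ex y.
  have [x zE] := apartments_generate n_gt0 (valP z).
  have [m mE] := apartment_class_multiple xi0_fund n_gt0.
  have cyc M : apartment_chain M \in cycles (order_complex (Tits n)) n.-1.
    rewrite unfold_in (prednK n_gt0).
    by have [-> ->] := apartment_chain_cycle M; rewrite eqxx.
  exists (x *~ m).
  pose c := mlin (fun M => CycleGroup (cyc M)) x.
  have -> : z = c.
    apply: val_inj; rewrite zE.
    pose F := GRing.Additive.clone _ _ (val \o mlin (fun M => CycleGroup (cyc M))) _.
    suff: mlin (@apartment_chain n) x = F x by [].
    by apply: additive_eq_in => M _; rewrite /= !mlin1.
  have -> : phi (x *~ m) = mlin (fun M => apartment_class M xi0 *~ m) x.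
    rewrite raddfMz /= mlin.unlock mulrz_suml.
    by apply: eq_bigr => M _; rewrite mulrzAC.
  pose G := GRing.Additive.clone _ _
    (@class_of _ _ _ _ \o mlin (fun M => CycleGroup (cyc M))) _.
  suff: mlin (fun M => apartment_class M xi0 *~ m) x = G x by [].
  by apply: additive_eq_in => M _; rewrite /= !mlin1 mE -hclassE.
by apply/seteqP; split=> y [M ->]; exists M; rewrite phi1.
Qed.
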